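(* The monic Laurent biorthogonal polynomials $P_n(z)$ with moments $c_k=e^{\gamma wk+\gamma\alpha}\,\dfrac{\sigma(wk+\beta+\alpha)}{\sigma(wk+\alpha)\sigma(\beta)}$, $k\in\mathbb Z$, satisfy $P_0=1$, $P_1(z)=z-d_0$ and the three-term recurrence relation $$P_{n+1}(z)+(d_n-z)P_n(z)=z\,b_n\,P_{n-1}(z),\qquad n\ge1,$$ with, for $\hat\alpha=\alpha/w$, $\hat\beta=\beta/w$, $$d_n=e^{\gamma w}\,\frac{[\hat\alpha-n]\,[\hat\beta+(\hat\alpha+1)(n+1)]\,[\hat\beta+\hat\alpha n]}{[\hat\alpha+n+1]\,[\hat\beta+(\hat\alpha+1)n]\,[\hat\beta+\hat\alpha(n+1)]},\qquad n\ge0,$$ $$b_n=-e^{\gamma w}\,\frac{[n]^2\,[\hat\beta+(\hat\alpha+1)(n+1)]\,[\hat\beta+\hat\alpha(n-1)]}{[\hat\beta+(\hat\alpha+1)n]\,[\hat\beta+\hat\alpha n]\,[\hat\alpha+n]\,[\hat\alpha+n+1]},\qquad n\ge1.$$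
   Context: $\sigma$ denotes the Weierstrass sigma function of the lattice $\Lambda=2\omega_1\mathbb Z+2\omega_3\mathbb Z$ with $\omega_1>0$ and $\omega_3\in i\mathbb R_{>0}$. The parameter $w$ is real with $wN_1\ne\omega_1N_2$ for all integers $(N_1,N_2)\ne(0,0)$; $\alpha,\beta,\gamma\in\mathbb C$. Nondegeneracy: $\alpha\notin w\mathbb Z+\Lambda$ and, for all integers $n\ge0$, $\beta+n\alpha\notin\Lambda$ and $\beta+n(\alpha+w)\notin\Lambda$. Elliptic numbers: $[x]=\sigma(wx)/\sigma(w)$. The polynomials are defined by $$P_n(z)=\frac1{\Delta_n}\begin{vmatrix} c_0&c_1&\dots&c_n\\ c_{-1}&c_0&\dots&c_{n-1}\\ \vdots&\vdots&&\vdots\\ c_{1-n}&c_{2-n}&\dots&c_1\\ 1&z&\dots&z^n\end{vmatrix},\qquad \Delta_n=\det(c_{k-i})_{i,k=0,\dots,n-1},\quad \Delta_0=1,$$ and $\Delta_n\neq0$ because $w$ is real with $wN_1\ne\omega_1N_2$ for all integers $(N_1,N_2)\ne(0,0)$, $\alpha\notin w\mathbb Z+\Lambda$, and $\beta+n\alpha\notin\Lambda$ for all integers $n\ge0$. *)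

(* Defs.v *)
From HB Require Import structures.
From mathcomp Require Import all_boot all_order all_algebra.
From mathcomp Require Import all_classical reals topology normedtype sequences.
From mathcomp Require Import exp trigo.
From mathcomp Require Export complex.
Set Implicit Arguments.
Unset Strict Implicit.
Unset Printing Implicit Defensive.
Import Order.TTheory GRing.Theory Num.Theory.
Import numFieldNormedType.Exports.
Local Open Scope classical_set_scope.
Local Open Scope complex_scope.
Local Open Scope ring_scope.

Section ComplexAnalysis.
Context {R : realType}.

Definition cexp (z : R[i]) : R[i] :=
  (expR (complex.Re z) * cos (complex.Im z)) +i*
  (expR (complex.Re z) * sin (complex.Im z)).

(* Componentwise limit.  As with [limn], the value is meaningful only for
   convergent sequences. *)
Definition climn (u : nat -> R[i]) : R[i] :=
  limn (fun n => complex.Re (u n)) +i* limn (fun n => complex.Im (u n)).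

End ComplexAnalysis.

Section WeierstrassSigma.
Context {R : realType}.
Variables omega1 omega3 : R[i].  (* half-periods *)

Definition lattice_pt (m n : int) : R[i] :=
  2 * omega1 * m%:~R + 2 * omega3 * n%:~R.

Definition lattice : set (R[i]) :=
  [set x | exists m n : int, x = lattice_pt m n].

(* The integers -N, ..., N. *)
Definition int_box (N : nat) : seq int :=
  [seq k%:Z - N%:Z | k <- iota 0 N.*2.+1].

Definition weierstrass_factor (z l : R[i]) : R[i] :=
  (1 - z / l) * cexp (z / l + z ^+ 2 / (2 * l ^+ 2)).

Definition sigma_partial (z : R[i]) (N : nat) : R[i] :=
  z * \prod_(m <- int_box N) \prod_(n <- int_box N | (m, n) != (0, 0))
        weierstrass_factor z (lattice_pt m n).

(* sigma(z) = z \prod_(l in lattice, l != 0) (1 - z/l) e^(z/l + z^2/(2 l^2)).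
   The product converges absolutely when omega1 and omega3 are linearly
   independent over the reals, so that exhausting the lattice by the boxes
   |m|, |n| <= N involves no choice. *)
Definition sigma (z : R[i]) : R[i] := climn (sigma_partial z).

(* Elliptic number [x]. *)
Definition elliptic_number (w : R) (x : R[i]) : R[i] :=
  sigma (w%:C * x) / sigma w%:C.

Definition moment (w : R) (alpha beta gamma : R[i]) (k : int) : R[i] :=
  cexp (gamma * w%:C * k%:~R + gamma * alpha) *
  (sigma (w%:C * k%:~R + beta + alpha) /
   (sigma (w%:C * k%:~R + alpha) * sigma beta)).

Definition coef_d (w : R) (alpha beta gamma : R[i]) (n : nat) : R[i] :=
  let br := elliptic_number w in
  let a := alpha / w%:C in
  let b := beta / w%:C in
  cexp (gamma * w%:C) *
  ((br (a - n%:R) * br (b + (a + 1) * (n%:R + 1)) * br (b + a * n%:R)) /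
   (br (a + n%:R + 1) * br (b + (a + 1) * n%:R) * br (b + a * (n%:R + 1)))).

(* Only used for n >= 1. *)
Definition coef_b (w : R) (alpha beta gamma : R[i]) (n : nat) : R[i] :=
  let br := elliptic_number w in
  let a := alpha / w%:C in
  let b := beta / w%:C in
  - cexp (gamma * w%:C) *
  ((br n%:R ^+ 2 * br (b + (a + 1) * (n%:R + 1)) * br (b + a * (n%:R - 1))) /
   (br (b + (a + 1) * n%:R) * br (b + a * n%:R) *
    br (a + n%:R) * br (a + n%:R + 1))).

End WeierstrassSigma.

Section LaurentBiorthogonal.
Context {K : fieldType}.
Variable c : int -> K.

Definition Delta (n : nat) : K :=
  \det (\matrix_(i < n, k < n) c (k%:Z - i%:Z)).

(* Meaningful only when [Delta n != 0] (otherwise it is 0). *)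
Definition lbp (n : nat) : {poly K} :=
  (Delta n)^-1 *: \det (\matrix_(i < n.+1, k < n.+1)
     if (i < n)%N then (c (k%:Z - i%:Z))%:P else 'X^k).

End LaurentBiorthogonal.

(* Main.v *)
(** Let L be the linear functional with L(z^k) = c_k.  The polynomials Q_n defined by
the recurrence satisfy the explicit formula
  L(Q_n z^(-i)) = K_n g^(-i) sigma(beta + (n+1) alpha + w (n-i))
      prod_(j<n) sigma(w (i-j)) / prod_(k<=n) sigma(alpha + w (k-i)),  g = e^(gamma w),
whose right-hand side is a Frobenius determinant of elliptic Cauchy type.  By
induction on n this is a four-term identity between products of three sigmas,
obtained from two instances of Weierstrass' three-term identity.  The formula vanishes
for 0 <= i < n and not for i = n, so that Q_n is orthogonal, the Toeplitz
determinants do not vanish, and P_n = Q_n.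

The three-term identity is derived from the product over the lattice.  Truncated to
|m| <= K, |n| <= M with K <= M, the product is e^(c z^2) times a polynomial with c
bounded, and a Gaussian factor e^(c z^2) only multiplies the identity by a common
factor.  By Euler's sine product the polynomial tends, as M tends to infinity, to a
truncated theta product, which the q-binomial theorem turns in the limit into a
theta series T (the proof of Jacobi's triple product).  Splitting the double series
T(x+y)T(x-y) by parity gives A(x)B(y) - B(x)A(y), from which the identity is a
Pluecker relation. *)

Require Import Defs.
From HB Require Import structures.
From mathcomp Require Import all_boot all_order all_algebra.
From mathcomp Require Import all_classical reals topology normedtype sequences.
From mathcomp Require Import derive realfun exp trigo complex.
From mathcomp Require Import zify ring lra.
Set Implicit Arguments.
Unset Strict Implicit.
Unset Printing Implicit Defensive.
Import Order.TTheory GRing.Theory Num.Theory.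
Import numFieldNormedType.Exports.
Local Open Scope classical_set_scope.
Local Open Scope complex_scope.
Local Open Scope ring_scope.

(** * Laurent biorthogonal polynomials with elliptic moments *)

(** The obstacle is that the sum of 1/l^2 over the lattice, which is the coefficient of z^2 in the
    Gaussian factor, does not converge absolutely: its value depends on the shape of the truncation.
    The rectangles are therefore sent to infinity in two stages, M first at fixed K, where the rows
    in the imaginary direction become sines, and then K. The truncated products with the Gaussian
    factor converge uniformly over all rectangles K <= M, so one sufficiently large M chosen for
    each K serves both limits. The exponent has to be bounded along this choice, because the
    Gaussian multiplies a three-term expression that tends to 0. All convergence is measured by a
    single weight 1/((k+1)(k+2)), whose tails are at most 1/(K+1). The sine product, the theta
    series and the lattice product all get errors of the form C/(K+1), which makes the exchanges of
    limits explicit. The algebraic part is carried out for an arbitrary odd function with the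
    three-term identity, over a field where 2 is invertible, since the identity is applied at
    half-sums. *)

Definition three_term {K : pzRingType} (S : K -> K) (x y z t : K) : K :=
  S (x + y) * S (x - y) * S (z + t) * S (z - t) +
  S (y + z) * S (y - z) * S (x + t) * S (x - t) +
  S (z + x) * S (z - x) * S (y + t) * S (y - t).

Section LaurentMoments.
Context {K : fieldType}.
Variable c : int -> K.

(** The value L(p z^(-i)). [N] is the number of coefficients read, so the value is the right one
    only if [size p <= N]; a common [N] lets polynomials of different sizes be added termwise. *)
Definition moment_functional (N : nat) (p : {poly K}) (i : int) : K :=
  \sum_(k < N) p`_k * c (k%:Z - i).

Lemma moment_functional_widen N M (p : {poly K}) i : (size p <= N)%N -> (N <= M)%N ->
  moment_functional M p i = moment_functional N p i.
Proof.
move=> sp NM; rewrite /moment_functional.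
rewrite [RHS](big_ord_widen M (fun k : nat => p`_k * c (k%:Z - i)) NM).
rewrite [RHS]big_mkcond /=; apply: eq_bigr => k _; case: ifP => // kN.
by rewrite nth_default ?mul0r// (leq_trans sp)// leqNgt kN.
Qed.

Lemma moment_functionalD N p q i :
  moment_functional N (p + q) i = moment_functional N p i + moment_functional N q i.
Proof. by rewrite -big_split; apply: eq_bigr => k _; rewrite coefD mulrDl. Qed.

Lemma moment_functionalC N a p i :
  moment_functional N (a%:P * p) i = a * moment_functional N p i.
Proof. by rewrite mulr_sumr; apply: eq_bigr => k _; rewrite coefCM mulrA. Qed.

Lemma moment_functionalX N p i :
  moment_functional N.+1 ('X * p) i = moment_functional N p (i - 1).
Proof.
rewrite /moment_functional big_ord_recl coefXM mul0r add0r.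
apply: eq_bigr => k _; rewrite coefXM /=; congr (_ * c _).
by rewrite /bump /= add1n; lia.
Qed.

(** Cramer's rule: [\adj M] applied to both sides gives [\det M] times the last entry of [v], and on
    the right only the corner cofactor survives, with sign +1. The ring is arbitrary because the
    lemma serves both for scalar Toeplitz matrices and for the matrix of [lbp], whose entries are
    polynomials. *)
Lemma det_last_column (A : comNzRingType) (n : nat) (M : 'M[A]_n.+1) (v : 'cV[A]_n.+1)
    (s : A) : v ord_max 0 = 1 -> M *m v = \col_i (s *+ (i == ord_max)) ->
  \det M = s * \det (\matrix_(i < n, k < n) M (widen_ord (leqnSn n) i) (widen_ord (leqnSn n) k)).
Proof.
move=> v1 Mv; have := congr1 (fun B => (\adj M *m B) ord_max 0) Mv.
rewrite mulmxA mul_adj_mx mul_scalar_mx !mxE v1 mulr1 => ->.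
rewrite (bigD1 ord_max) //= big1 ?addr0; last first.
  by move=> i /negPf ni; rewrite !mxE ni mulr0.
rewrite !mxE eqxx mulr1n mulrC /cofactor -signr_odd oddD addbb expr0 mul1r.
congr (_ * \det _); apply/matrixP => i k; rewrite !mxE.
by congr (M _ _); apply/val_inj; rewrite /= /bump leqNgt ltn_ord.
Qed.

(** The coefficients of [p] combine the columns of the Toeplitz matrix into (0, ..., 0, L(p
    z^(-n))). Non-vanishing of the determinants is thereby reduced to that of these norms. *)
Lemma Delta_recr n (p : {poly K}) : p \is monic -> size p = n.+1 ->
    (forall i, (i < n)%N -> moment_functional n.+1 p i%:Z = 0) ->
  Delta c n.+1 = moment_functional n.+1 p n%:Z * Delta c n.
Proof.
move=> pm sp p0.
rewrite /Delta (@det_last_column _ n _ (\col_k p`_k) (moment_functional n.+1 p n%:Z)).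
- congr (_ * \det _); apply/matrixP => i k; rewrite !mxE //=.
- by rewrite mxE /=; move/monicP: pm; rewrite /lead_coef sp.
apply/colP => i; rewrite !mxE.
transitivity (moment_functional n.+1 p i%:Z).
  by apply: eq_bigr => k _; rewrite !mxE mulrC.
have [->|ni] := eqVneq i ord_max; first by rewrite mulr1n.
rewrite mulr0n p0 //; have := ltn_ord i; rewrite ltnS leq_eqVlt => /orP[/eqP e|//].
by case/eqP: ni; apply/val_inj.
Qed.

(** The same combination of columns, now with last row 1, z, ..., z^n, yields (0, ..., 0, p), so the
    determinant is [p] times [Delta c n]. *)
Lemma lbp_orthogonal n (p : {poly K}) : p \is monic -> size p = n.+1 ->
    (forall i, (i < n)%N -> moment_functional n.+1 p i%:Z = 0) ->
  Delta c n != 0 -> lbp c n = p.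
Proof.
move=> pm sp p0 D0.
rewrite /lbp (@det_last_column _ n _ (\col_k (p`_k)%:P) p).
- set M := (X in \det X).
  have -> : \det M = (Delta c n)%:P.
    rewrite /Delta -det_map_mx /=; congr (\det _); apply/matrixP => i k.
    by rewrite !mxE /= ltn_ord.
  by rewrite mulrC mul_polyC scalerA mulVf // scale1r.
- by rewrite mxE /=; move/monicP: pm; rewrite /lead_coef sp => ->.
apply/colP => i; rewrite !mxE.
have [->|ni] := eqVneq i ord_max.
  rewrite mulr1n /= -[RHS]coefK poly_def sp; apply: eq_bigr => k _.
  by rewrite !mxE /= ltnn mulrC mul_polyC.
have iN : (i < n)%N.
  have := ltn_ord i; rewrite ltnS leq_eqVlt => /orP[/eqP e|//].
  by case/eqP: ni; apply/val_inj.
rewrite mulr0n; transitivity ((moment_functional n.+1 p i%:Z)%:P); last by rewrite p0.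
rewrite /moment_functional rmorph_sum /=.
by apply: eq_bigr => k _; rewrite !mxE iN mulrC rmorphM.
Qed.

End LaurentMoments.

(** * Recurrence and orthogonality for moments built from an odd function with the three-term
    identity *)

Section EllipticMoments.
Context {K : numFieldType}.
Variables (S : K -> K) (w a b g C0 : K).
Hypothesis SN : forall x, S (- x) = - S x.
Hypothesis S3 : forall x y z t, three_term S x y z t = 0.
Hypothesis g0 : g != 0.
Hypothesis C00 : C0 != 0.
Hypothesis Sw : forall n : nat, S (w * n.+1%:R) != 0.
Hypothesis Sa : forall k : int, S (a + w * k%:~R) != 0.
Hypothesis Sb : forall n : nat, S (b + n%:R * a) != 0.
Hypothesis Sb' : forall n : nat, S (b + n%:R * (a + w)) != 0.

Let c (k : int) : K := C0 * g ^ k * (S (w * k%:~R + b + a) / S (w * k%:~R + a)).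

Definition ell_d (n : nat) : K :=
  g * (S (a - w * n%:R) * S (b + n.+1%:R * (a + w)) * S (b + n%:R * a)) /
   (S (a + w * n.+1%:R) * S (b + n%:R * (a + w)) * S (b + n.+1%:R * a)).

(* [ell_b n] is the coefficient b_(n+1). *)
Definition ell_b (n : nat) : K :=
  - g * (S (w * n.+1%:R) ^+ 2 * S (b + n.+2%:R * (a + w)) * S (b + n%:R * a)) /
   (S (b + n.+1%:R * (a + w)) * S (b + n.+1%:R * a) *
    S (a + w * n.+1%:R) * S (a + w * n.+2%:R)).

(** Two consecutive polynomials are carried along, so that the two-step recurrence becomes a
    structural recursion. *)
Fixpoint ell_pair (n : nat) : {poly K} * {poly K} :=
  if n is m.+1 then
    let: (p, q) := ell_pair m in
    (q, ('X - (ell_d m.+1)%:P) * q + 'X * (ell_b m)%:P * p)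
  else (1, 'X - (ell_d 0)%:P).

Definition ell_poly n := (ell_pair n).1.

Lemma ell_poly0 : ell_poly 0 = 1. Proof. by []. Qed.

Lemma ell_poly1 : ell_poly 1 = 'X - (ell_d 0)%:P. Proof. by []. Qed.

Lemma ell_polySS n : ell_poly n.+2 =
  ('X - (ell_d n.+1)%:P) * ell_poly n.+1 + 'X * (ell_b n)%:P * ell_poly n.
Proof. by rewrite /ell_poly /=; case: (ell_pair n). Qed.

Lemma ell_poly_monic n : ell_poly n \is monic /\ size (ell_poly n) = n.+1.
Proof.
suff: (ell_poly n \is monic /\ size (ell_poly n) = n.+1) /\
      (ell_poly n.+1 \is monic /\ size (ell_poly n.+1) = n.+2) by case.
elim: n => [|n [[pm ps] [qm qs]]].
  rewrite ell_poly0 ell_poly1 monic1 size_poly1 monicXsubC size_XsubC.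
  by [].
split=> //; rewrite ell_polySS.
have s1 : size (('X - (ell_d n.+1)%:P) * ell_poly n.+1 : {poly K}) = n.+3.
  by rewrite size_Mmonic ?size_XsubC ?qs // monic_neq0 // monicXsubC.
have s2 : (size ('X * (ell_b n)%:P * ell_poly n)%R < n.+3)%N.
  rewrite -mulrA mul_polyC mulrC -scalerAl (leq_ltn_trans (size_scale_leq _ _))//.
  by rewrite size_mulX ?ps// monic_neq0.
split; last by rewrite size_polyDl s1.
rewrite monicE lead_coefDl ?s1// -monicE.
by rewrite monicMl // monicXsubC.
Qed.

(** The constant K_n of the explicit formula; the ratio of consecutive values is the constant in
    front of the left-hand side of [four_term]. *)
Fixpoint ell_K (n : nat) : K :=
  if n is m.+1 then
    ell_K m * (- g * S (w * m.+1%:R) * S (b + m%:R * a) /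
               (S (b + m.+1%:R * a) * S (a + w * m.+1%:R)))
  else C0.

Lemma ell_K_neq0 n : ell_K n != 0.
Proof.
have SaN m : S (a + w * m%:R) != 0 by rewrite -[m%:R]/(m%:Z%:~R) Sa.
elim: n => //= n IH; rewrite !(mulf_neq0, invr_neq0) ?oppr_eq0 //.
Qed.

Let num (n : nat) (i : int) := \prod_(j < n) S (w * (i - j%:Z)%:~R).
Let den (n : nat) (i : int) := \prod_(k < n) S (a + w * (k%:Z - i)%:~R).

Definition ell_u (n : nat) (i : int) : K :=
  ell_K n * g ^ (- i) * S (b + n.+1%:R * a + w * (n%:Z - i)%:~R) *
  num n i / den n.+1 i.

Lemma den_neq0 n i : den n i != 0.
Proof. by apply/prodf_neq0 => k _; apply: Sa. Qed.

Lemma num_recl n i : num n.+1 i = S (w * i%:~R) * num n (i - 1).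
Proof.
rewrite /num big_ord_recl subr0; congr (_ * _); apply: eq_bigr => j _.
by congr (S (w * _%:~R)); rewrite /= /bump /=; lia.
Qed.

Lemma num_recr n i : num n.+1 i = num n i * S (w * (i - n%:Z)%:~R).
Proof. by rewrite /num big_ord_recr. Qed.

Lemma den_recl n i : den n.+1 i = S (a - w * i%:~R) * den n (i - 1).
Proof.
rewrite /den big_ord_recl sub0r rmorphN mulrN; congr (_ * _); apply: eq_bigr => j _.
by congr (S (a + w * _%:~R)); rewrite /= /bump /=; lia.
Qed.

Lemma den_recr n i : den n.+1 i = den n i * S (a + w * (n%:Z - i)%:~R).
Proof. by rewrite /den big_ord_recr. Qed.


(** The four arguments are solved from the sums and differences wanted, up to three signs absorbed
    by oddness. In use, [N] is w (n+1), [y] is b + (n+1) a, and [i] is w times the index. *)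
Lemma three_term_I (y N i : K) :
  S (N + w) * S (y + N) * S (y + a + a + N + w - i) * S (i - N) =
  S (a - N) * S (y + a + N + w) * S (y + a + N - i) * S (a + N + w - i) -
  S (a + w) * S (y + a) * S (a - i) * S (y + a + N + N + w - i).
Proof.
have := S3 (y / 2 + N + w / 2) (- y / 2 + w / 2) (y / 2 + a + w / 2)
  (y / 2 + N + a + w / 2 - i).
rewrite /three_term.
have h2 : (2 : K) != 0 by rewrite pnatr_eq0.
rewrite (_ : y / 2 + N + w / 2 + _ = N + w); last by field.
rewrite (_ : y / 2 + N + w / 2 - (- y / 2 + w / 2) = y + N); last by field.
rewrite (_ : y / 2 + a + w / 2 + (y / 2 + N + a + w / 2 - i) = y + a + a + N + w - i);
  last by field.
rewrite (_ : y / 2 + a + w / 2 - (y / 2 + N + a + w / 2 - i) = i - N); last by field.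
rewrite (_ : - y / 2 + w / 2 + (y / 2 + a + w / 2) = a + w); last by field.
rewrite (_ : - y / 2 + w / 2 - (y / 2 + a + w / 2) = - (y + a)); last by field.
rewrite (_ : y / 2 + N + w / 2 + (y / 2 + N + a + w / 2 - i) = y + a + N + N + w - i);
  last by field.
rewrite (_ : y / 2 + N + w / 2 - (y / 2 + N + a + w / 2 - i) = - (a - i)); last by field.
rewrite (_ : y / 2 + a + w / 2 + (y / 2 + N + w / 2) = y + a + N + w); last by field.
rewrite (_ : y / 2 + a + w / 2 - (y / 2 + N + w / 2) = a - N); last by field.
rewrite (_ : - y / 2 + w / 2 + (y / 2 + N + a + w / 2 - i) = a + N + w - i);
  last by field.
rewrite (_ : - y / 2 + w / 2 - (y / 2 + N + a + w / 2 - i) = - (y + a + N - i));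
  last by field.
rewrite !SN => h; rewrite -[RHS]addr0 -{}h; ring.
Qed.

Lemma three_term_II (y N i : K) :
  S (y + N) * S (a + N + w) * S (y + a + N + w - i) * S (i - N) =
  S y * S (a + w) * S i * S (y + a + N + N + w - i) -
  S N * S (y + a + N + w) * S (y + N - i) * S (a + N + w - i).
Proof.
have := S3 (y / 2 + N + a / 2 + w / 2) (y / 2 - a / 2 - w / 2) (y / 2 + a / 2 + w / 2)
  (y / 2 + N + a / 2 + w / 2 - i).
rewrite /three_term.
have h2 : (2 : K) != 0 by rewrite pnatr_eq0.
set A := _ + _ - i.
rewrite (_ : y / 2 + N + a / 2 + w / 2 + (_ - _) = y + N); last by field.
rewrite (_ : y / 2 + N + a / 2 + w / 2 - (y / 2 - a / 2 - w / 2) = a + N + w); last by field.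
rewrite (_ : y / 2 + a / 2 + w / 2 + A = y + a + N + w - i); last by rewrite /A; field.
rewrite (_ : y / 2 + a / 2 + w / 2 - A = i - N); last by rewrite /A; field.
rewrite (_ : y / 2 - a / 2 - w / 2 + (y / 2 + a / 2 + w / 2) = y); last by field.
rewrite (_ : y / 2 - a / 2 - w / 2 - (y / 2 + a / 2 + w / 2) = - (a + w)); last by field.
rewrite (_ : y / 2 + N + a / 2 + w / 2 + A = y + a + N + N + w - i); last by rewrite /A; field.
rewrite (_ : y / 2 + N + a / 2 + w / 2 - A = i); last by rewrite /A; field.
rewrite (_ : y / 2 + a / 2 + w / 2 + (y / 2 + N + a / 2 + w / 2) = y + a + N + w); last by field.
rewrite (_ : y / 2 + a / 2 + w / 2 - (y / 2 + N + a / 2 + w / 2) = - N); last by field.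
rewrite (_ : y / 2 - a / 2 - w / 2 + A = y + N - i); last by rewrite /A; field.
rewrite (_ : y / 2 - a / 2 - w / 2 - A = - (a + N + w - i)); last by rewrite /A; field.
rewrite !SN => h; rewrite -[RHS]addr0 -{}h; ring.
Qed.

(** Both identities above involve S(y+a+2N+w-i), which occurs in none of the four terms here.
    Identity I rewrites the left-hand side, identity II the first term on the right; the two
    contributions with this factor cancel, and the rest are the terms in d and b. *)
Lemma four_term (y N i : K) : S (y + N) != 0 -> S (y + a) != 0 -> S (a + N + w) != 0 ->
  - g * (S (N + w) * S y / (S (y + a) * S (a + N + w))) *
    S (y + a + a + N + w - i) * S i * S (i - N) =
  g * S (y + a + N + w - i) * S (i - N) * S (a - i) -
  g * (S (a - N) * S (y + a + N + w) * S y / (S (a + N + w) * S (y + N) * S (y + a))) *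
    S (y + a + N - i) * S i * S (a + N + w - i) +
  g * (S N * S (y + a + N + w) / (S (y + N) * S (a + N + w))) *
    S (y + N - i) * S (a - i) * S (a + N + w - i).
Proof.
move=> h1 h2 h3.
have I1 := three_term_I y N i.
have I2 := three_term_II y N i.
have E1 : S (N + w) * S (y + a + a + N + w - i) * S (i - N) =
  (S (a - N) * S (y + a + N + w) * S (y + a + N - i) * S (a + N + w - i) -
  S (a + w) * S (y + a) * S (a - i) * S (y + a + N + N + w - i)) / S (y + N).
  by rewrite -I1; field.
have E2 : S (y + a + N + w - i) * S (i - N) =
  (S y * S (a + w) * S i * S (y + a + N + N + w - i) -
  S N * S (y + a + N + w) * S (y + N - i) * S (a + N + w - i)) / (S (y + N) * S (a + N + w)).
  by rewrite -I2; field; rewrite h1 h3.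
transitivity (- g * S y * S i / (S (y + a) * S (a + N + w)) *
   (S (N + w) * S (y + a + a + N + w - i) * S (i - N))).
  by field; rewrite h2 h3.
rewrite E1 -[g * _ * S (i - N)]mulrA E2.
by field; rewrite h1 h2 h3.
Qed.

Lemma ell_u_rec n i : ell_u n.+2 i =
  ell_u n.+1 (i - 1) - ell_d n.+1 * ell_u n.+1 i + ell_b n * ell_u n (i - 1).
Proof.
have eg : g ^ (- (i - 1)) = g ^ (- i) * g.
  by rewrite (_ : - (i - 1) = - i + 1) ?expfzDr ?expr1z//; lia.
(* Passing from [i] to [i - 1] changes [num] and [den] only by end factors, so all terms share
   [num n (i - 1)] and [den n.+1 (i - 1)]; what remains is [four_term]. *)
rewrite /ell_u eg (num_recl n.+1 i) (num_recr n (i - 1)) (num_recl n i).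
rewrite (den_recl n.+2 i) (den_recr n.+1 (i - 1)) (den_recl n.+1 i).
have D0 : den n.+1 (i - 1) != 0 by apply: den_neq0.
have A1 : S (a - w * i%:~R) != 0 by have := Sa (- i); rewrite rmorphN mulrN.
have A2 : S (a + w * (n.+1%:Z - (i - 1))%:~R) != 0 by apply: Sa.
have G0 : g ^ (- i) != 0 by rewrite expfz_neq0.
have K0 := ell_K_neq0 n.
move: (num n (i - 1)) (den n.+1 (i - 1)) D0 A1 A2 (g ^ (- i)) G0 => Z D D0 A1 A2 G G0.
rewrite /ell_d /ell_b /=; move: (ell_K n) K0 => k0 k00.
pose y : K := b + n.+1%:R * a; pose N : K := w * n.+1%:R; pose x : K := w * i%:~R.
have e1 : b + n.+3%:R * a + w * (n.+2%:Z - i)%:~R = y + a + a + N + w - x.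
  by rewrite /y /N /x; ring.
have e2 : w * (i - 1 - n%:Z)%:~R = x - N by rewrite /x /N; ring.
have e3 : a + w * (n.+1%:Z - (i - 1))%:~R = a + N + w - x by rewrite /x /N; ring.
have e4 : b + n.+2%:R * a + w * (n.+1%:Z - (i - 1))%:~R = y + a + N + w - x.
  by rewrite /y /x /N; ring.
have e5 : b + n.+2%:R * a + w * (n.+1%:Z - i)%:~R = y + a + N - x.
  by rewrite /y /x /N; ring.
have e6 : b + n.+1%:R * a + w * (n%:Z - (i - 1))%:~R = y + N - x.
  by rewrite /y /x /N; ring.
have e7 : b + n.+2%:R * (a + w) = y + a + N + w by rewrite /y /N; ring.
have e8 : b + n.+1%:R * (a + w) = y + N by rewrite /y /N; ring.
have e9 : b + n.+2%:R * a = y + a by rewrite /y; ring.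
have e10 : w * n.+2%:R = N + w by rewrite /N; ring.
have e11 : a + w * n.+2%:R = a + N + w by rewrite /N; ring.
have nz1 := Sb' n.+1; have nz2 := Sb n.+2; have nz3 := Sa n.+2; have nz4 := Sb n.+1.
have nz5 := Sw n; have nz6 := Sa n.+1; have nz7 := Sb n.
rewrite [n.+2%:Z%:~R]/(n.+2%:R) e11 in nz3; rewrite [n.+1%:Z%:~R]/(n.+1%:R) -/N in nz6.
rewrite e1 e2 e4 e3 e5 e6 e7 e8 e9 e11 e10 -/N -/y -/x.
rewrite e3 in A2; rewrite -/x in A1.
rewrite e8 in nz1; rewrite e9 in nz2; rewrite -/y in nz4; rewrite -/N in nz5.
have F := four_term x nz1 nz2 nz3.
have {}F : S (y + a + a + N + w - x) * S x * S (x - N) * (- g * S (N + w) * S y) =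
  (g * S (y + a + N + w - x) * S (x - N) * S (a - x) -
  g * (S (a - N) * S (y + a + N + w) * S y / (S (a + N + w) * S (y + N) * S (y + a))) *
    S (y + a + N - x) * S x * S (a + N + w - x) +
  g * (S N * S (y + a + N + w) / (S (y + N) * S (a + N + w))) *
    S (y + N - x) * S (a - x) * S (a + N + w - x)) * (S (y + a) * S (a + N + w)).
  by rewrite -F; field; rewrite nz2 nz3.
set Y := b + n%:R * a in nz7 *.
transitivity (k0 * (- g * S N * S Y / (S y * S (a + N))) * G * Z / (D * S (a - x) *
  S (a + N + w - x) * S (y + a) * S (a + N + w)) *
  (S (y + a + a + N + w - x) * S x * S (x - N) * (- g * S (N + w) * S y))).
  by field; rewrite ?nz2 ?nz3 ?nz4 ?nz6 ?A1 ?A2 ?D0.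
rewrite {}F.
by field; rewrite ?nz1 ?nz2 ?nz3 ?nz4 ?nz6 ?A1 ?A2 ?D0.
Qed.

Lemma ell_u1 i : ell_u 1 i = ell_u 0 (i - 1) - ell_d 0 * ell_u 0 i.
Proof.
have eg : g ^ (- (i - 1)) = g ^ (- i) * g.
  by rewrite (_ : - (i - 1) = - i + 1) ?expfzDr ?expr1z//; lia.
rewrite /ell_u eg num_recl {1 2 3}/num !big_ord0 !mulr1.
rewrite (den_recl 1 i) (_ : den 1 i = S (a - w * i%:~R)); last first.
  by rewrite den_recl /den big_ord0 mulr1.
rewrite (_ : den 1 (i - 1) = S (a + w * (0 - (i - 1))%:~R)); last first.
  by rewrite den_recr /den big_ord0 mul1r.
have A1 : S (a - w * i%:~R) != 0 by have := Sa (- i); rewrite rmorphN mulrN.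
have A2 : S (a + w * (0 - (i - 1))%:~R) != 0 by apply: Sa.
have G0 : g ^ (- i) != 0 by rewrite expfz_neq0.
move: (g ^ (- i)) G0 => G G0.
rewrite /ell_d /=; pose x : K := w * i%:~R.
have nz1 := Sb' 0; have nz2 := Sb 1; have nz3 := Sa 1.
rewrite !mul0r ?addr0 mul1r in nz1 nz2; rewrite [1%:~R]/(1 : K) mulr1 in nz3.
rewrite !mul0r !mulr0 subr0 !addr0 !mul1r mulr1.
(* There is no earlier polynomial here, so the first identity at N = 0 alone gives the relation. *)
have F := three_term_I b 0 x; rewrite !(add0r, addr0, subr0) in F.
have e1 : b + 2%:R * a + w * (1 - i)%:~R = b + a + a + w - x by rewrite /x; ring.
have e2 : a + w * (0 - (i - 1))%:~R = a + w - x by rewrite /x; ring.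
have e3 : b + a + w * (0 - (i - 1))%:~R = b + a + w - x by rewrite /x; ring.
have e4 : b + a + w * (0 - i)%:~R = b + a - x by rewrite /x; ring.
have e5 : b + (a + w) = b + a + w by ring.
rewrite e1 e3 e2 e4 e5 -/x; rewrite -/x in A1; rewrite e2 in A2.
transitivity (- g * C0 * G / (S (b + a) * S (a + w) * S (a - x) * S (a + w - x)) *
    (S w * S b * S (b + a + a + w - x) * S x)).
  by field; rewrite ?nz2 ?nz3 ?A1 ?A2.
by rewrite {}F; field; rewrite ?nz1 ?nz2 ?nz3 ?A1 ?A2.
Qed.
Lemma ell_u0 i : ell_u 0 i = c (- i).
Proof.
rewrite /ell_u /c /num /den big_ord0 big_ord1 /= mulr1 mul1r.
rewrite -!mulrA; congr (_ * (_ * (S _ * (S _)^-1))); ring.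
Qed.

Lemma moment_functional_ell_poly n i : moment_functional c n.+1 (ell_poly n) i = ell_u n i.
Proof.
suff: (forall i, moment_functional c n.+1 (ell_poly n) i = ell_u n i) /\
      (forall i, moment_functional c n.+2 (ell_poly n.+1) i = ell_u n.+1 i) by case.
elim: n {i} => [|n [IHp IHq]].
  have m0 i : moment_functional c 1 (ell_poly 0) i = ell_u 0 i.
    by rewrite /moment_functional big_ord1 coef1 mul1r sub0r ell_u0.
  split=> // i; rewrite ell_poly1 -polyCN -[_%:P]mulr1 -['X]mulr1 moment_functionalD.
  rewrite moment_functionalX moment_functionalC !m0 ell_u1.
  by rewrite (@moment_functional_widen _ _ 1) ?size_poly1// m0 mulNr.
split=> // i; have [_ sp] := ell_poly_monic n; have [_ sq] := ell_poly_monic n.+1.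
rewrite ell_polySS mulrBl -mulNr -polyCN -mulrA !moment_functionalD.
rewrite !moment_functionalX !moment_functionalC IHq ell_u_rec mulNr.
rewrite (@moment_functional_widen _ _ n.+2) ?sq// IHq.
by rewrite (@moment_functional_widen _ _ n.+1) ?sp// IHp.
Qed.

Lemma ell_orthogonal n i : (i < n)%N -> moment_functional c n.+1 (ell_poly n) i%:Z = 0.
Proof.
move=> lt_in; rewrite moment_functional_ell_poly /ell_u (_ : num n i%:Z = 0).
  by rewrite mulr0 mul0r.
(* The factor j = i is S 0, and S 0 = 0 by oddness. *)
rewrite /num (bigD1 (Ordinal lt_in)) //= subrr mulr0 (_ : S 0 = 0) ?mul0r//.
by have := SN 0; rewrite oppr0 => /eqP; rewrite -subr_eq0 opprK -mulr2n mulrn_eq0 => /eqP.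
Qed.

(** At i = n the differences n - j run from 1 to n, so [Sw] keeps every factor of [num] away from
    0. *)
Lemma ell_norm_neq0 n : moment_functional c n.+1 (ell_poly n) n%:Z != 0.
Proof.
rewrite moment_functional_ell_poly /ell_u subrr mulr0 addr0.
rewrite !(mulf_neq0, invr_neq0) ?ell_K_neq0 ?expfz_neq0 ?den_neq0//.
apply/prodf_neq0 => j _; rewrite (_ : (n%:Z - j%:Z)%:~R = (n - j.+1).+1%:R) //.
by rewrite -subSn ?ltn_ord // subSS natrB ?rmorphB // ltnW ?ltn_ord.
Qed.

Lemma ell_Delta_neq0 n : Delta c n != 0.
Proof.
elim: n => [|n IH]; first by rewrite /Delta det_mx00 oner_neq0.
have [pm sp] := ell_poly_monic n.
by rewrite (Delta_recr pm sp (@ell_orthogonal n)) mulf_neq0 ?ell_norm_neq0.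
Qed.

Lemma lbp_ell_poly n : lbp c n = ell_poly n.
Proof.
have [pm sp] := ell_poly_monic n.
exact: (lbp_orthogonal pm sp (@ell_orthogonal n) (ell_Delta_neq0 n)).
Qed.

End EllipticMoments.

(** * Modulus and limits in the complex field *)

Section ComplexModulus.
Context {R : realType}.
Implicit Types (x y z : R[i]).

(** Values lie in the ordered field [R], where [lra] and [nra] apply, rather than in [R[i]]. *)
Definition cabs z : R := Normc.normc z.

Lemma cabs_sqr z : cabs z ^+ 2 = complex.Re z ^+ 2 + complex.Im z ^+ 2.
Proof. by case: z => a b; rewrite /cabs /= sqr_sqrtr // addr_ge0 ?sqr_ge0. Qed.

Lemma cabs_ge0 z : 0 <= cabs z.
Proof. by case: z => a b; rewrite /cabs /= sqrtr_ge0. Qed.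

Lemma cabs0 : cabs 0 = 0. Proof. exact: Normc.normc0. Qed.

Lemma cabs1 : cabs 1 = 1. Proof. exact: Normc.normc1. Qed.

Lemma cabsM x y : cabs (x * y) = cabs x * cabs y. Proof. exact: Normc.normcM. Qed.

Lemma cabsD x y : cabs (x + y) <= cabs x + cabs y. Proof. exact: le_normcD. Qed.

Lemma cabsN x : cabs (- x) = cabs x. Proof. exact: normcN. Qed.

Lemma cabsC x y : cabs (x - y) = cabs (y - x). Proof. by rewrite -cabsN opprB. Qed.

Lemma cabsB x y : cabs (x - y) <= cabs x + cabs y.
Proof. by rewrite -(cabsN y) cabsD. Qed.

Lemma cabsV x : cabs x^-1 = (cabs x)^-1. Proof. exact: Normc.normcV. Qed.

Lemma cabs_eq0 z : (cabs z == 0) = (z == 0).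
Proof.
by apply/eqP/eqP => [|->]; [exact: Normc.eq0_normc | exact: cabs0].
Qed.

Lemma cabs_gt0 z : (0 < cabs z) = (z != 0).
Proof. by rewrite lt_def cabs_ge0 andbT cabs_eq0. Qed.

Lemma cabsX z n : cabs (z ^+ n) = cabs z ^+ n.
Proof. by elim: n => [|n IH]; rewrite ?expr0 ?cabs1 // !exprS cabsM IH. Qed.

Lemma cabs_real (a : R) : cabs a%:C = `|a|.
Proof. by rewrite /cabs /= expr0n /= addr0 sqrtr_sqr. Qed.

Lemma cabs_nat n : cabs n%:R = n%:R.
Proof. by rewrite -[n%:R](rmorph_nat (real_complex R)) cabs_real ger0_norm. Qed.

Lemma Re_le_cabs z : `|complex.Re z| <= cabs z.
Proof.
rewrite -(@ler_pXn2r _ 2) ?nnegrE ?cabs_ge0 //.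
by rewrite cabs_sqr -normrX ger0_norm ?sqr_ge0 // lerDl sqr_ge0.
Qed.

Lemma Im_le_cabs z : `|complex.Im z| <= cabs z.
Proof.
rewrite -(@ler_pXn2r _ 2) ?nnegrE ?cabs_ge0 //.
by rewrite cabs_sqr -normrX ger0_norm ?sqr_ge0 // lerDr sqr_ge0.
Qed.

Lemma cabs_le_ReIm z : cabs z <= `|complex.Re z| + `|complex.Im z|.
Proof.
rewrite [in cabs z](complexE z) (le_trans (cabsD _ _)) // cabsM !cabs_real.
by rewrite (_ : cabs 'i%C = 1) ?mul1r // /cabs /= expr0n expr1n add0r sqrtr1.
Qed.

Lemma cabs_sum (I : Type) (s : seq I) (P : pred I) (f : I -> R[i]) :
  cabs (\sum_(i <- s | P i) f i) <= \sum_(i <- s | P i) cabs (f i).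
Proof.
elim/big_rec2: _ => [|i u v _ h]; first by rewrite cabs0.
by rewrite (le_trans (cabsD _ _)) // lerD2l.
Qed.

Lemma cabs_dist3 x y z : cabs (x - z) <= cabs (x - y) + cabs (y - z).
Proof. by rewrite (le_trans _ (cabsD _ _)) // subrKA. Qed.

Lemma cabs_lbD x y : cabs x - cabs y <= cabs (x + y).
Proof. by rewrite lerBlDr -{1}(addrK y x) cabsB. Qed.

(* Multiplicative perturbations are controlled by the exponential of the total
   size, so that no smallness assumption is needed. *)
Lemma cabs_prod1D (I : Type) (s : seq I) (P : pred I) (a : I -> R[i]) :
  cabs (\prod_(i <- s | P i) (1 + a i) - 1) <=
  expR (\sum_(i <- s | P i) cabs (a i)) - 1.
Proof.
elim/big_rec2: _ => [|i u v _ h]; first by rewrite subrr cabs0 expR0 subrr.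
have -> : (1 + a i) * v - 1 = (v - 1) + a i * ((v - 1) + 1) by ring.
rewrite (le_trans (cabsD _ _)) // cabsM expRD.
have h1 := expR_ge1Dx (cabs (a i)); have h2 := cabsD (v - 1) 1; rewrite cabs1 in h2.
have h3 := cabs_ge0 (a i); have h4 := expR_gt0 u.
have h5 : cabs (a i) * cabs (v - 1 + 1) <= cabs (a i) * expR u.
  by rewrite ler_wpM2l //; lra.
nra.
Qed.

Lemma expR_sub1_le (s : R) : 0 <= s -> expR s - 1 <= s * expR s.
Proof.
move=> s0; have := expR_ge1Dx (- s); rewrite expRN => h.
have e0 := expR_gt0 s.
have : (1 - s) * expR s <= (expR s)^-1 * expR s by rewrite ler_wpM2r // ltW.
by rewrite mulVf ?gt_eqF //; lra.
Qed.

Lemma cabs_prod1D_le (I : Type) (s : seq I) (P : pred I) (a : I -> R[i]) (B : R) :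
  \sum_(i <- s | P i) cabs (a i) <= B ->
  cabs (\prod_(i <- s | P i) (1 + a i) - 1) <= B * expR B.
Proof.
move=> h; have B0 : 0 <= B by apply: le_trans h; apply: sumr_ge0 => i _; apply: cabs_ge0.
rewrite (le_trans (cabs_prod1D _ _ _)) // (le_trans _ (expR_sub1_le B0)) //.
by rewrite lerD2r ler_expR.
Qed.

End ComplexModulus.

Section ComplexLimits.
Context {R : realType}.
Implicit Types (u v : nat -> R[i]) (l m : R[i]).

(** Convergence stated through [cabs]; [ctends_climn] connects it with the componentwise limit in
    the definition of [sigma]. *)
Definition ctends u l :=
  forall e : R, 0 < e -> exists N, forall n, (N <= n)%N -> cabs (u n - l) < e.

Lemma small_inv (C e : R) : 0 < e -> exists N, forall n, (N <= n)%N -> C / n.+1%:R < e.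
Proof.
move=> e0; exists (Num.bound `|C / e|) => n hn.
rewrite ltr_pdivrMr // mulrC -ltr_pdivrMr //.
rewrite (le_lt_trans (ler_norm _)) // (lt_le_trans (archi_boundP _)) //.
by rewrite ler_nat (leq_trans hn).
Qed.

Lemma ctends_le u l (C : R) : (forall n, cabs (u n - l) <= C / n.+1%:R) -> ctends u l.
Proof.
move=> h e /(small_inv C)[N hN]; exists N => n /hN; exact: le_lt_trans.
Qed.

Lemma ctends_cst l : ctends (fun=> l) l.
Proof. by move=> e e0; exists 0%N => n _; rewrite subrr cabs0. Qed.

Lemma eq_ctends u v l : (forall n, u n = v n) -> ctends u l -> ctends v l.
Proof. by move=> uv h e /h[N hN]; exists N => n /hN; rewrite uv. Qed.

Lemma ctendsD u v l m : ctends u l -> ctends v m -> ctends (fun n => u n + v n) (l + m).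
Proof.
move=> hu hv e e0; have e2 : 0 < e / 2 by lra.
have [N1 h1] := hu _ e2; have [N2 h2] := hv _ e2.
exists (maxn N1 N2) => n; rewrite geq_max => /andP[/h1 {}h1 /h2 {}h2].
have -> : u n + v n - (l + m) = (u n - l) + (v n - m) by ring.
by rewrite (le_lt_trans (cabsD _ _)) //; lra.
Qed.

Lemma ctends_bounded u l : ctends u l -> exists2 C : R, 0 < C & forall n, cabs (u n) <= C.
Proof.
move=> h; have [N hN] := h 1 ltr01.
exists (cabs l + 1 + \sum_(i < N) cabs (u i)).
  by rewrite ltr_pwDl ?sumr_ge0 ?ltr_wpDl ?cabs_ge0 // => i _; apply: cabs_ge0.
move=> n; have [nN|nN] := ltnP n N.
  rewrite (bigD1 (Ordinal nN)) //= addrCA lerDl addr_ge0 ?sumr_ge0 //.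
    by rewrite addr_ge0 ?cabs_ge0.
  by move=> i _; apply: cabs_ge0.
rewrite ler_wpDr ?sumr_ge0 // => [i _|]; first exact: cabs_ge0.
rewrite -[u n](subrK l) (le_trans (cabsD _ _)) // addrC lerD2l.
by rewrite ltW // hN.
Qed.

Lemma ctends0M u v (C : R) : (forall n, cabs (u n) <= C) -> ctends v 0 ->
  ctends (fun n => u n * v n) 0.
Proof.
move=> hu hv e e0.
have C1 : 0 < `|C| + 1 by rewrite ltr_wpDl.
have [N hN] := hv (e / (`|C| + 1)) (divr_gt0 e0 C1).
exists N => n /hN; rewrite !subr0 cabsM ltr_pdivlMr // => h.
have := hu n; have := ler_norm C; have := cabs_ge0 (v n); have := cabs_ge0 (u n).
nra.
Qed.

Lemma ctends_sub0 u l : ctends u l <-> ctends (fun n => u n - l) 0.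
Proof.
by split=> h e /h [N hN]; exists N => n /hN; rewrite subr0.
Qed.

Lemma ctendsM u v l m : ctends u l -> ctends v m -> ctends (fun n => u n * v n) (l * m).
Proof.
move=> hu hv; have [C _ hC] := ctends_bounded hu.
apply/ctends_sub0; rewrite -[0]addr0.
apply: (@eq_ctends (fun n => u n * (v n - m) + m * (u n - l))) => [n|]; first by ring.
apply: ctendsD; first by apply: (ctends0M hC); apply/(ctends_sub0 v m).
by apply: (@ctends0M _ _ (cabs m)) => //; apply/(ctends_sub0 u l).
Qed.

Lemma ctendsZ u l m : ctends u l -> ctends (fun n => m * u n) (m * l).
Proof. by apply: ctendsM; apply: ctends_cst. Qed.

Lemma ctendsN u l : ctends u l -> ctends (fun n => - u n) (- l).
Proof.
move=> h; rewrite -mulN1r; apply: (@eq_ctends (fun n => -1 * u n)) => [n|].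
  by rewrite mulN1r.
exact: ctendsZ.
Qed.

Lemma ctendsB u v l m : ctends u l -> ctends v m -> ctends (fun n => u n - v n) (l - m).
Proof. by move=> hu hv; apply: ctendsD => //; apply: ctendsN. Qed.

Lemma ctendsX u l k : ctends u l -> ctends (fun n => u n ^+ k) (l ^+ k).
Proof.
move=> h; elim: k => [|k IH]; first exact: ctends_cst.
apply: (@eq_ctends (fun n => u n * u n ^+ k)) => [n|]; first by rewrite exprS.
by rewrite exprS; apply: ctendsM.
Qed.

Lemma ctendsV u l : l != 0 -> ctends u l -> ctends (fun n => (u n)^-1) l^-1.
Proof.
move=> l0 h e e0; have a0 : 0 < cabs l by rewrite cabs_gt0.
have [N1 h1] := h (cabs l / 2) (divr_gt0 a0 (ltr0n _ 2)).
have e1 : 0 < e * (cabs l ^+ 2 / 2) by rewrite mulr_gt0 // divr_gt0 // exprn_gt0.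
have [N2 h2] := h _ e1.
exists (maxn N1 N2) => n; rewrite geq_max => /andP[/h1 {}h1 /h2 {}h2].
have hl : cabs l / 2 <= cabs (u n).
  have := cabs_lbD l (u n - l); rewrite [l + _]addrC subrK; lra.
have u0 : u n != 0 by rewrite -cabs_gt0; lra.
have -> : (u n)^-1 - l^-1 = (l - u n) / (u n * l) by field; rewrite u0 l0.
have ul0 : 0 < cabs (u n * l) by rewrite cabs_gt0 mulf_neq0.
rewrite cabsM cabsV ltr_pdivrMr // cabsC (lt_le_trans h2) // ler_wpM2l ?(ltW e0) //.
by rewrite cabsM; nra.
Qed.

Lemma ctends_sum (I : Type) (s : seq I) (P : pred I) (u : nat -> I -> R[i]) (l : I -> R[i]) :
  (forall i, ctends (fun n => u n i) (l i)) ->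
  ctends (fun n => \sum_(i <- s | P i) u n i) (\sum_(i <- s | P i) l i).
Proof.
move=> h; elim: s => [|i s IH].
  by rewrite big_nil; apply: (@eq_ctends (fun=> 0)) (ctends_cst 0) => n; rewrite big_nil.
rewrite big_cons; case: ifP => Pi.
  apply: (@eq_ctends (fun n => u n i + \sum_(j <- s | P j) u n j)).
    by move=> n; rewrite big_cons Pi.
  exact: ctendsD.
by apply: eq_ctends IH => n; rewrite big_cons Pi.
Qed.

Lemma ctends_prod (I : Type) (s : seq I) (P : pred I) (u : nat -> I -> R[i]) (l : I -> R[i]) :
  (forall i, ctends (fun n => u n i) (l i)) ->
  ctends (fun n => \prod_(i <- s | P i) u n i) (\prod_(i <- s | P i) l i).
Proof.
move=> h; elim: s => [|i s IH].
  by rewrite big_nil; apply: (@eq_ctends (fun=> 1)) (ctends_cst 1) => n; rewrite big_nil.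
rewrite big_cons; case: ifP => Pi.
  apply: (@eq_ctends (fun n => u n i * \prod_(j <- s | P j) u n j)).
    by move=> n; rewrite big_cons Pi.
  exact: ctendsM.
by apply: eq_ctends IH => n; rewrite big_cons Pi.
Qed.

Lemma ctends_uniq u l m : ctends u l -> ctends u m -> l = m.
Proof.
move=> hl hm; apply/eqP; rewrite -subr_eq0 -cabs_eq0; apply/negP => /negP.
rewrite cabs_eq0 -cabs_gt0 => a0; have a2 : 0 < cabs (l - m) / 2 by lra.
have [N1 h1] := hl _ a2; have [N2 h2] := hm _ a2.
have := h1 _ (leq_maxl N1 N2); have := h2 _ (leq_maxr N1 N2).
set n := maxn _ _; have := cabs_dist3 l (u n) m; rewrite [cabs (l - u n)]cabsC; lra.
Qed.

Lemma ctends_lb u l (a : R) N : ctends u l -> (forall n, (N <= n)%N -> a <= cabs (u n)) ->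
  a <= cabs l.
Proof.
move=> h hu; rewrite leNgt; apply/negP => la.
have d0 : 0 < a - cabs l by lra.
have [M hM] := h _ d0; have := hM _ (leq_maxr N M); have := hu _ (leq_maxl N M).
set n := maxn _ _; have := cabsD (u n - l) l; rewrite subrK; lra.
Qed.

Lemma ctends_ub u l (a : R) N : ctends u l -> (forall n, (N <= n)%N -> cabs (u n) <= a) ->
  cabs l <= a.
Proof.
move=> h hu; rewrite leNgt; apply/negP => la.
have d0 : 0 < cabs l - a by lra.
have [M hM] := h _ d0; have := hM _ (leq_maxr N M); have := hu _ (leq_maxl N M).
set n := maxn _ _; have := cabsD (u n) (l - u n); rewrite [u n + _]addrC subrK [cabs (l - _)]cabsC.
lra.
Qed.

(** The slack [c] admits index maps that lag behind n by a constant, such as n -> |n + i| with i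
    negative. *)
Lemma ctends_subseq u l (f : nat -> nat) (c : nat) : (forall n, (n <= f n + c)%N) ->
  ctends u l -> ctends (fun n => u (f n)) l.
Proof.
move=> hf h e /h[N hN]; exists (N + c)%N => n Nn; apply: hN.
by have := leq_trans Nn (hf n); rewrite leq_add2r.
Qed.

Lemma ctends_ReIm u l : ctends u l ->
  (fun n => complex.Re (u n)) @ \oo --> complex.Re l /\
  (fun n => complex.Im (u n)) @ \oo --> complex.Im l.
Proof.
move=> h; split; apply/cvgrPdist_lt => e /h [N hN]; exists N => // n /= /hN;
  apply: le_lt_trans; rewrite cabsC.
  by rewrite (_ : _ - _ = complex.Re (l - u n)) ?Re_le_cabs //; case: (l) (u n) => [? ?][? ?].
by rewrite (_ : _ - _ = complex.Im (l - u n)) ?Im_le_cabs //; case: (l) (u n) => [? ?][? ?].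
Qed.

Lemma ctends_climn u l : ctends u l -> climn u = l.
Proof.
move=> /ctends_ReIm[hr hi]; rewrite /climn (cvg_lim _ hr) // (cvg_lim _ hi) //.
by case: (l).
Qed.

Lemma ctends_cauchy u (C : R) :
  (forall n k, (n <= k)%N -> cabs (u k - u n) <= C / n.+1%:R) ->
  exists2 l, ctends u l & forall n, cabs (l - u n) <= C / n.+1%:R.
Proof.
move=> h.
have key (f : R[i] -> R) : (forall x y, `|f x - f y| <= cabs (x - y)) ->
    cvgn (fun n => f (u n)).
  move=> hf; apply/cauchy_cvgP/cauchy_exP => e e0.
  have [N hN] := small_inv C e0.
  exists (f (u N)); exists N => // n /= Nn; rewrite /ball /= distrC.
  by rewrite (le_lt_trans (hf _ _)) // (le_lt_trans (h _ _ Nn)) // hN.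
have hr : cvgn (fun n => complex.Re (u n)).
  by apply: key => x y; rewrite (_ : _ - _ = complex.Re (x - y)) ?Re_le_cabs //;
     case: (x) (y) => [? ?][? ?].
have hi : cvgn (fun n => complex.Im (u n)).
  by apply: key => x y; rewrite (_ : _ - _ = complex.Im (x - y)) ?Im_le_cabs //;
     case: (x) (y) => [? ?][? ?].
have hl : ctends u (climn u).
  move=> e e0; have e2 : 0 < e / 2 by lra.
  move/cvgrPdist_lt: hr => /(_ _ e2) [N1 _ h1].
  move/cvgrPdist_lt: hi => /(_ _ e2) [N2 _ h2].
  exists (maxn N1 N2) => n; rewrite geq_max => /andP[/h1 /= {}h1 /h2 /= {}h2].
  rewrite cabsC (le_lt_trans (cabs_le_ReIm _)) //.
  rewrite (_ : complex.Re _ = lim ((complex.Re (u m)) @[m --> \oo]) - complex.Re (u n));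
    last by case: (u n).
  rewrite (_ : complex.Im _ = lim ((complex.Im (u m)) @[m --> \oo]) - complex.Im (u n));
    last by case: (u n).
  lra.
exists (climn u) => // n.
have hn := ctendsB hl (ctends_cst (u n)).
by apply: (ctends_ub hn) => k; apply: h.
Qed.

(* Moore-Osgood: the diagonal u has the limit of the iterated limits. *)
Lemma ctends_interchange (u : nat -> R[i]) (f : nat -> nat -> R[i]) (g : nat -> R[i])
    (C : R) l :
  (forall K, ctends (fun M => f M K) (g K)) ->
  (forall K M, (K <= M)%N -> cabs (u M - f M K) <= C / K.+1%:R) ->
  ctends g l <-> ctends u l.
Proof.
move=> hf hu; split=> h.
  move=> e e0; have e3 : 0 < e / 3 by lra.
  have [N1 h1] := small_inv C e3; have [N2 h2] := h _ e3.
  have [K K1 K2] : exists2 K, (N1 <= K)%N & (N2 <= K)%N.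
    by exists (maxn N1 N2); [exact: leq_maxl | exact: leq_maxr].
  have [N3 h3] := hf K _ e3.
  exists (maxn K N3) => M; rewrite geq_max => /andP[KM /h3 {}h3].
  have := h1 K K1; have := h2 K K2; have := hu _ _ KM.
  have := cabs_dist3 (u M) (f M K) l; have := cabs_dist3 (f M K) (g K) l.
  move: (C / _) => q; lra.
(* Conversely, letting M tend to infinity in the bound at fixed K shows that g K is within C/(K+1)
   of l. *)
apply: (@ctends_le _ _ C) => K; rewrite cabsC.
have hn := ctendsB h (hf K).
by apply: (ctends_ub hn) => M; apply: hu.
Qed.

End ComplexLimits.

(** * Elementary estimates for the complex exponential *)

Section RealTrigBounds.
Context {R : realType}.
Implicit Types (a b : R).

Lemma sin_sub_bound b : 0 <= b -> exists2 c, 0 <= c <= b & b - sin b = (1 - cos c) * b.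
Proof.
move=> b0; have der x : x \in `]0, b[ -> is_derive x 1 (fun x => x - sin x) (1 - cos x).
  by move=> _; apply: is_deriveB.
have cont : {within `[0, b], continuous (fun x => x - sin x)}.
  by apply: continuous_subspaceT => x; apply: cvgB; [exact: cvg_id | exact: continuous_sin].
have [c] := MVT_segment b0 der cont.
by rewrite in_itv /= sin0 !subr0 => hc e; exists c.
Qed.

Lemma norm_sin_le b : `|sin b| <= `|b|.
Proof.
wlog b0 : b / 0 <= b => [h|].
  by have [/h//|/ltW b0] := leP 0 b; rewrite -normrN -sinN -[`|b|]normrN h // oppr_ge0.
rewrite [`|b|]ger0_norm // ler_norml; apply/andP; split; last first.
  have [c _ e] := sin_sub_bound b0; have := cos_le1 c; nra.
have der x : x \in `]0, b[ -> is_derive x 1 (fun x => x + sin x) (1 + cos x).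
  by move=> _; apply: is_deriveD.
have cont : {within `[0, b], continuous (fun x => x + sin x)}.
  by apply: continuous_subspaceT => x; apply: cvgD; [exact: cvg_id | exact: continuous_sin].
have [c _] := MVT_segment b0 der cont.
by rewrite sin0 subr0 addr0 => e; have := cos_geN1 c; nra.
Qed.

Lemma cos_half b : cos b = 1 - 2 * sin (b / 2) ^+ 2.
Proof.
rewrite -{1}(_ : b / 2 + b / 2 = b) ?cosD; last by field.
have := cos2Dsin2 (b / 2); nra.
Qed.

Lemma one_sub_cos_bound b : 0 <= 1 - cos b <= b ^+ 2 / 2.
Proof.
have h := norm_sin_le (b / 2); have : sin (b / 2) ^+ 2 <= (b / 2) ^+ 2.
  by rewrite -(ger0_norm (sqr_ge0 (sin _))) -(ger0_norm (sqr_ge0 (b / 2))) !normrX lerXn2r ?nnegrE.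
have := sqr_ge0 (sin (b / 2)); rewrite (cos_half b) => h1 h2; apply/andP; split; lra.
Qed.

Lemma norm_sin_sub_le b : `|sin b - b| <= `|b| * b ^+ 2 / 2.
Proof.
wlog b0 : b / 0 <= b => [h|].
  have [/h//|/ltW b0] := leP 0 b; have := h (- b); rewrite sinN normrN sqrrN oppr_ge0 => /(_ b0).
  by rewrite -opprD normrN.
have [c /andP[c0 cb] e] := sin_sub_bound b0.
have /andP[h1 h2] := one_sub_cos_bound c.
rewrite distrC e normrM (ger0_norm b0) (ger0_norm h1) mulrC -mulrA.
by rewrite ler_wpM2l // (le_trans h2) //; nra.
Qed.

Lemma expR_bounds a : `|a| <= 2^-1 -> [/\ expR a <= 2, `|expR a - 1| <= 2 * `|a| &
  `|expR a - 1 - a| <= 2 * a ^+ 2].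
Proof.
move=> ha; have := ha; rewrite ler_norml => /andP[a1 a2].
have h1 := expR_ge1Dx a; have h2 := expR_ge1Dx (- a); have e0 := expR_gt0 a.
have h3 : (1 - a) * expR a <= 1.
  have e1 : expR (- a) * expR a = 1 by rewrite -expRD addNr expR0.
  by nra.
have h4 : expR a <= 2 by nra.
have h5 : expR a - 1 - a <= 2 * a ^+ 2 by nra.
have h6 : `|expR a - 1 - a| <= 2 * a ^+ 2 by rewrite ger0_norm //; lra.
split => //; have -> : expR a - 1 = (expR a - 1 - a) + a by ring.
rewrite (le_trans (ler_normD _ _)) //.
have : a ^+ 2 = `|a| ^+ 2 by rewrite -normrX ger0_norm ?sqr_ge0.
have := normr_ge0 a; nra.
Qed.

(** With h = b/2 in [0, 1], the earlier bounds give sin h >= h/2 and cos h >= 1/2; the duplication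
    formula multiplies them. The cubic bound at b itself would be void near 2. *)
Lemma sin_lower_bound b : 0 <= b <= 2 -> b / 4 <= sin b.
Proof.
move=> /andP[b0 b2]; have -> : sin b = 2 * sin (b / 2) * cos (b / 2).
  by rewrite -{1}(_ : b / 2 + b / 2 = b) ?sinD; [ring | field].
have /andP[_ h1] := one_sub_cos_bound (b / 2).
have := norm_sin_sub_le (b / 2); rewrite (ger0_norm (_ : 0 <= b / 2)); last by lra.
rewrite ler_norml => /andP[h2 _].
have h3 : 1 / 2 <= cos (b / 2) by nra.
have h4 : b / 4 <= sin (b / 2) by nra.
nra.
Qed.

End RealTrigBounds.

Section ComplexExponential.
Context {R : realType}.
Implicit Types (x y z h : R[i]).

Lemma cexpD x y : cexp (x + y) = cexp x * cexp y.
Proof.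
case: x y => [a b] [c d]; rewrite /cexp /= expRD cosD sinD.
by apply/eqP; rewrite eq_complex /=; apply/andP; split; apply/eqP; ring.
Qed.

Lemma cexp_real (a : R) : cexp a%:C = (expR a)%:C.
Proof. by rewrite /cexp /= cos0 sin0 mulr1 mulr0. Qed.

Lemma cexp0 : cexp (0 : R[i]) = 1.
Proof. by rewrite (cexp_real 0) expR0. Qed.

Lemma cexpNM x : cexp (- x) * cexp x = 1.
Proof. by rewrite -cexpD addNr cexp0. Qed.

Lemma cexp_neq0 x : cexp x != 0.
Proof.
by apply/eqP => e; have := cexpNM x; rewrite e mulr0 => /esym/eqP; rewrite oner_eq0.
Qed.

Lemma cexpN x : cexp (- x) = (cexp x)^-1.
Proof. by rewrite -[RHS]mul1r -(cexpNM x) mulfK ?cexp_neq0. Qed.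

Lemma cexp_sum (I : Type) (s : seq I) (P : pred I) (f : I -> R[i]) :
  cexp (\sum_(i <- s | P i) f i) = \prod_(i <- s | P i) cexp (f i).
Proof. exact: (big_morph cexp cexpD cexp0). Qed.

Lemma cexp_nat x n : cexp (x * n%:R) = cexp x ^+ n.
Proof.
elim: n => [|n IH]; first by rewrite mulr0 cexp0.
by rewrite mulrSr mulrDr mulr1 cexpD IH exprSr.
Qed.

Lemma cexp_int x (n : int) : cexp (x * n%:~R) = cexp x ^ n.
Proof.
case: n => n; first exact: cexp_nat.
by rewrite NegzE rmorphN mulrN cexpN -exprnN -cexp_nat.
Qed.

Lemma cabs_cexp z : cabs (cexp z) = expR (complex.Re z).
Proof.
apply/eqP; rewrite -(@eqrXn2 _ 2) ?cabs_ge0 ?expR_ge0 // cabs_sqr /=.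
by rewrite !exprMn -mulrDr cos2Dsin2 mulr1.
Qed.

Lemma cabs_cexp_le z : cabs (cexp z) <= expR (cabs z).
Proof. by rewrite cabs_cexp ler_expR (le_trans (ler_norm _)) // Re_le_cabs. Qed.

Lemma cexp_taylor1_small h : cabs h <= 2^-1 -> cabs (cexp h - 1 - h) <= 3 * cabs h ^+ 2.
Proof.
move=> hh; rewrite cabs_sqr.
have ha := le_trans (Re_le_cabs h) hh; have hb := le_trans (Im_le_cabs h) hh.
apply: le_trans (cabs_le_ReIm _) _.
case: h {hh} ha hb => a b /= ha hb; rewrite subr0.
have [E1 E2 E3] := expR_bounds ha.
have /andP[c1 c2] := one_sub_cos_bound b; have S := norm_sin_sub_le b.
have S' : `|sin b - b| <= b ^+ 2 / 4 by rewrite (le_trans S) //; have := sqr_ge0 b; nra.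
have e0 := expR_gt0 a.
have r1 : `|expR a * cos b - 1 - a| <= 2 * a ^+ 2 + b ^+ 2.
  have -> : expR a * cos b - 1 - a = (expR a - 1 - a) - expR a * (1 - cos b) by ring.
  rewrite (le_trans (ler_normB _ _)) // lerD // normrM (gtr0_norm e0) (ger0_norm c1).
  by nra.
have r2 : `|expR a * sin b - b| <= b ^+ 2 / 2 + 2 * (`|a| * `|b|).
  have -> : expR a * sin b - b = expR a * (sin b - b) + (expR a - 1) * b by ring.
  rewrite (le_trans (ler_normD _ _)) // lerD // normrM ?(gtr0_norm e0).
    by have := normr_ge0 (sin b - b); nra.
  by rewrite mulrA ler_wpM2r.
have : 2 * (`|a| * `|b|) <= a ^+ 2 + b ^+ 2.
  rewrite -(ger0_norm (sqr_ge0 a)) -(ger0_norm (sqr_ge0 b)) !normrX.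
  by have := sqr_ge0 (`|a| - `|b|); nra.
lra.
Qed.

(** For |h| > 1/2 nothing is expanded: the left-hand side is at most e^B + 1 + B, and |h|^2 >= 1/4
    absorbs this, whence the factor 4. *)
Lemma cexp_taylor1 (B : R) : exists2 C : R, 0 <= C &
  forall h, cabs h <= B -> cabs (cexp h - 1 - h) <= C * cabs h ^+ 2.
Proof.
exists (3 + 4 * (expR B + 1 + `|B|)).
  by rewrite addr_ge0 ?mulr_ge0 ?addr_ge0 ?expR_ge0.
move=> h hB; have B0 : 0 <= B := le_trans (cabs_ge0 h) hB.
have q0 := sqr_ge0 (cabs h).
have eB := expR_gt0 B; rewrite (ger0_norm B0).
have [hs|hl] := leP (cabs h) 2^-1.
  by rewrite (le_trans (cexp_taylor1_small hs)) // ler_wpM2r //; nra.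
rewrite (le_trans (cabsB _ _)) // (le_trans (lerD (cabsB _ _) (lexx _))) // cabs1.
have h1 : cabs (cexp h) <= expR B by rewrite (le_trans (cabs_cexp_le h)) // ler_expR.
have h2 : 4^-1 <= cabs h ^+ 2 by nra.
apply: (@le_trans _ _ (expR B + 1 + B)); first by lra.
have : 0 <= expR B + 1 + B by lra.
nra.
Qed.

Definition csinh2 z : R[i] := cexp z - cexp (- z).

Lemma csinh2N z : csinh2 (- z) = - csinh2 z.
Proof. by rewrite /csinh2 opprK opprB. Qed.

Lemma ctends_csinh2 x : ctends (fun n => n.+1%:R * csinh2 (x / n.+1%:R)) (2 * x).
Proof.
have [C C0 hC] := cexp_taylor1 (cabs x).
apply: (@ctends_le _ _ _ (2 * C * cabs x ^+ 2)) => n.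
have n0 : n.+1%:R != 0 :> R[i] by rewrite pnatr_eq0.
have n1 : 1 <= n.+1%:R :> R by rewrite ler1n.
set h := x / n.+1%:R.
have hh : cabs h = cabs x / n.+1%:R by rewrite cabsM cabsV cabs_nat.
have hB : cabs h <= cabs x.
  by rewrite hh ler_pdivrMr ?ltr0n // ler_peMr ?cabs_ge0.
have -> : n.+1%:R * csinh2 h - 2 * x =
    n.+1%:R * ((cexp h - 1 - h) - (cexp (- h) - 1 - (- h))).
  rewrite /csinh2 (_ : x = n.+1%:R * h) /h; first by ring.
  by rewrite mulrC divfK.
rewrite cabsM cabs_nat.
have k1 := hC h hB; have k2 := hC (- h); rewrite cabsN in k2; have {}k2 := k2 hB.
apply: (@le_trans _ _ (n.+1%:R * (2 * (C * cabs h ^+ 2)))).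
  by rewrite ler_wpM2l ?ler0n // (le_trans (cabsB _ _)) //; lra.
rewrite hh expr_div_n le_eqVlt; apply/orP; left; apply/eqP.
by field; rewrite ?natr1 ?nat1r ?pnatr_eq0.
Qed.

End ComplexExponential.

(** * The sine product *)

Section DominatedProducts.
Context {R : realType}.

(* A summable weight whose tails telescope. *)
Definition weight (k : nat) : R := (k.+1%:R * k.+2%:R)^-1.

Lemma weight_ge0 k : 0 <= weight k.
Proof. by rewrite invr_ge0 mulr_ge0 ?ler0n. Qed.

Lemma weight_tail K M : (K <= M)%N ->
  \sum_(K <= k < M) weight k = K.+1%:R^-1 - M.+1%:R^-1.
Proof.
move=> KM; rewrite (eq_bigr (fun k => - k.+2%:R^-1 - - k.+1%:R^-1)) => [|k _].
  by rewrite (telescope_sumr (fun k => - k.+1%:R^-1 : R) KM) opprK addrC.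
have q0 : 0 < k.+1%:R :> R by rewrite ltr0n.
rewrite /weight -[k.+2%:R]natr1; move: (k.+1%:R) q0 => q q0.
by field; rewrite !gt_eqF //; lra.
Qed.

Lemma weight_tail_le K M : \sum_(K <= k < M) weight k <= K.+1%:R^-1.
Proof.
have [KM|/ltnW MK] := leqP K M; last by rewrite big_geq // invr_ge0 ler0n.
by rewrite weight_tail // gerBl invr_ge0 ler0n.
Qed.

Lemma weight_sum_le M : \sum_(k < M) weight k <= 1.
Proof. by rewrite -(big_mkord xpredT) (le_trans (weight_tail_le 0 M)) // invr1. Qed.

Lemma prod_nat_split (F : pzSemiRingType) (f : nat -> F) K M : (K <= M)%N ->
  \prod_(k < M) f k = (\prod_(k < K) f k) * \prod_(K <= k < M) f k.
Proof. by move=> KM; rewrite -!(big_mkord xpredT f) (big_cat_nat (leq0n K) KM). Qed.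

Lemma dominated_prod_le (a : nat -> R[i]) (C : R) M : 0 <= C ->
  (forall k, (k < M)%N -> cabs (a k) <= C * weight k) ->
  cabs (\prod_(k < M) (1 + a k)) <= expR C.
Proof.
move=> C0 h; have -> : \prod_(k < M) (1 + a k) = (\prod_(k < M) (1 + a k) - 1) + 1 by ring.
rewrite (le_trans (cabsD _ _)) // cabs1 -lerBrDr (le_trans (cabs_prod1D _ _ _)) //.
rewrite lerD2r ler_expR; apply: (@le_trans _ _ (\sum_(k < M) C * weight k)).
  by apply: ler_sum => k _; apply: h.
by rewrite -mulr_sumr -[leRHS]mulr1 ler_wpM2l // weight_sum_le.
Qed.

Lemma dominated_prod_tail (a : nat -> R[i]) (C : R) K M : 0 <= C -> (K <= M)%N ->
  (forall k, (K <= k < M)%N -> cabs (a k) <= C * weight k) ->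
  cabs (\prod_(K <= k < M) (1 + a k) - 1) <= C * expR C / K.+1%:R.
Proof.
move=> C0 KM h.
have hs : \sum_(K <= k < M) cabs (a k) <= C / K.+1%:R.
  rewrite (le_trans (ler_sum_nat h)) // -mulr_sumr ler_wpM2l //.
  exact: weight_tail_le.
rewrite (le_trans (cabs_prod1D_le hs)) // mulrAC ler_wpM2r ?invr_ge0 ?ler0n //.
rewrite ler_wpM2l // ler_expR ler_pdivrMr ?ltr0n // ler_peMr // ler1n //.
Qed.

Lemma dominated_prod_diff (a : nat -> R[i]) (C : R) K M : 0 <= C -> (K <= M)%N ->
  (forall k, (k < M)%N -> cabs (a k) <= C * weight k) ->
  cabs (\prod_(k < M) (1 + a k) - \prod_(k < K) (1 + a k)) <=
    expR C * (C * expR C) / K.+1%:R.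
Proof.
move=> C0 KM h; rewrite (prod_nat_split (fun k => 1 + a k) KM).
have -> (x y : R[i]) : x * y - x = x * (y - 1) by ring.
rewrite cabsM -mulrA ler_pM ?cabs_ge0 //.
  by apply: dominated_prod_le => // k kK; apply: h; apply: leq_trans KM.
by apply: dominated_prod_tail => // k /andP[_]; apply: h.
Qed.

End DominatedProducts.

(** * Euler's product for 2 sinh, from roots of unity *)

Section SineProduct.
Context {R : realType}.
Implicit Types (x X : R[i]).

(** Pairs the index k+1 with 2M-k, its opposite modulo 2M+1; for powers of a root of unity of that
    order the two are complex conjugates. *)
Lemma prod_fold_odd (F : comPzSemiRingType) (f : nat -> F) M :
  \prod_(0 <= i < M.*2.+1) f i = f 0%N * \prod_(k < M) (f k.+1 * f (M.*2 - k)%N).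
Proof.
rewrite big_nat_recl // -addnn; congr (_ * _).
rewrite (big_cat_nat (leq0n M) (leq_addr M M)) /= big_split /=; congr (_ * _).
  by rewrite big_mkord.
rewrite -[X in \prod_(X <= _ < _) _]add0n big_addn addnK big_nat_rev big_mkord.
apply: eq_bigr => k _; congr f; have := ltn_ord k; lia.
Qed.

Let cis (t : R) : R[i] := cexp (0 +i* t).

Lemma cisE t : cis t = cos t +i* sin t.
Proof. by rewrite /cis /cexp /= expR0 !mul1r. Qed.

Lemma cisX t n : cis t ^+ n = cis (t * n%:R).
Proof.
rewrite -cexp_nat; congr cexp; rewrite -(rmorph_nat (real_complex R)).
by apply/eqP; rewrite eq_complex /=; apply/andP; split; apply/eqP; ring.
Qed.

Lemma cis_2pi : cis (pi *+ 2) = 1.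
Proof. by rewrite cisE cos2pi sin2pi. Qed.

Lemma cis_addN t : cis t + cis (- t) = (2 - 4 * sin (t / 2) ^+ 2)%:C.
Proof.
rewrite !cisE cosN sinN cos_half.
by apply/eqP; rewrite eq_complex /=; apply/andP; split; apply/eqP; ring.
Qed.

Lemma cis_mulN t : cis t * cis (- t) = 1.
Proof. by rewrite /cis -cexpD (_ : _ + _ = 0) ?cexp0 //; apply/eqP; rewrite eq_complex /= addr0 subrr !eqxx. Qed.

Let zeta (n : nat) := cis (pi *+ 2 / n%:R).

(** A smaller order m would give cos(2 pi m/n) = 1, that is sin(pi m/n) = 0 with 0 < m/n < 1. *)
Lemma zeta_prim n : (0 < n)%N -> n.-primitive_root (zeta n).
Proof.
move=> n0; have nz : n%:R != 0 :> R by rewrite pnatr_eq0 -lt0n.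
have z1 : zeta n ^+ n = 1 by rewrite cisX divfK // cis_2pi.
have [m pm mn] := prim_order_exists n0 z1.
have m0 := prim_order_gt0 pm.
have mz : m%:R != 0 :> R by rewrite pnatr_eq0 -lt0n.
have := prim_expr_order pm; rewrite cisX cisE => -[hc _].
have [e|ne] := eqVneq n m; first by rewrite [X in X.-primitive_root _]e.
have lt_mn : (m < n)%N by rewrite ltn_neqAle eq_sym ne dvdn_leq.
exfalso; move: hc; rewrite cos_half => h.
have : sin (pi *+ 2 / n%:R * m%:R / 2) ^+ 2 = 0 :> R by lra.
apply/eqP; rewrite sqrf_eq0 gt_eqF // sin_gt0_pi //.
have -> : pi *+ 2 / n%:R * m%:R / 2 = pi * (m%:R / n%:R) :> R by field.
rewrite mulr_gt0 ?pi_gt0 ?divr_gt0 ?ltr0n //=.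
by rewrite gtr_pMr ?pi_gt0 // ltr_pdivrMr ?ltr0n // mul1r ltr_nat.
Qed.

(** Odd, so that 1 is the only root of unity left without a conjugate partner. *)
Let nod (M : nat) : nat := M.*2.+1.
Let s2 (M k : nat) : R := 4 * sin (pi * k.+1%:R / (nod M)%:R) ^+ 2.

Lemma zeta_pair M k (t : R[i]) : (k < M)%N ->
  (t - zeta (nod M) ^+ k.+1) * (t - zeta (nod M) ^+ (M.*2 - k)) =
  t ^+ 2 + 1 - (2 - s2 M k)%:C * t.
Proof.
move=> kM; have nz : (nod M)%:R != 0 :> R by rewrite pnatr_eq0.
have -> : zeta (nod M) ^+ (M.*2 - k) = cis (- (pi *+ 2 / (nod M)%:R * k.+1%:R)).
  rewrite cisX (_ : (M.*2 - k)%:R = (nod M)%:R - k.+1%:R :> R); last first.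
    by rewrite -natrB ?ltnS; [congr (_%:R); rewrite /nod; lia | lia].
  rewrite mulrBr divfK // /cis.
  rewrite (_ : 0 +i* (pi *+ 2 - _) = (0 +i* (pi *+ 2)) + (0 +i* - (pi *+ 2 / (nod M)%:R * k.+1%:R))).
    by rewrite cexpD -!/(cis _) cis_2pi mul1r.
  by apply/eqP; rewrite eq_complex /= addr0 !eqxx.
rewrite cisX; set u := _ * k.+1%:R.
have -> : (t - cis u) * (t - cis (- u)) = t ^+ 2 + cis u * cis (- u) - (cis u + cis (- u)) * t.
  by ring.
rewrite cis_mulN cis_addN /s2; congr (_ - (_ - 4 * sin _ ^+ 2)%:C * _).
by rewrite /u; field.
Qed.

Let C2 : (2 : R)%:C = 2 :> R[i].
Proof. by rewrite rmorph_nat. Qed.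

(** The value of (X^n - 1)/(X - 1) at 1 is n, and at t = 1 the conjugate pair of [zeta_pair] equals
    [s2]. *)
Lemma prod_s2 M : \prod_(k < M) (s2 M k)%:C = (nod M)%:R :> R[i].
Proof.
have pz := @zeta_prim (nod M) isT; have := factor_Xn_sub_1 pz.
have X1 : 'X - 1 != 0 :> {poly R[i]} by rewrite -polyC1 polyXsubC_eq0.
rewrite subrX1 {1}/nod big_nat_recl // expr0 polyC1 => /(mulfI X1) /(congr1 (fun p => p.[1])).
rewrite horner_prod horner_sum.
under [X in _ = X -> _]eq_bigr do rewrite hornerXn expr1n.
rewrite sumr_const card_ord => <-.
transitivity (\prod_(k < M) ((1 - zeta (nod M) ^+ k.+1) * (1 - zeta (nod M) ^+ (M.*2 - k)))).
  apply: eq_bigr => k _; rewrite zeta_pair //.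
  by rewrite expr1n mulr1 rmorphB /= C2; ring.
have := prod_fold_odd (fun i => if i == 0%N then 1 else 1 - zeta (nod M) ^+ i) M.
rewrite big_nat_recl //= !mul1r => h.
under [RHS]eq_bigr do rewrite hornerXsubC.
rewrite {}h; apply: eq_bigr => k _; rewrite ifF //.
by have := ltn_ord k; lia.
Qed.

(** X^n - 1 is evaluated at t = e^(2x) and divided by e^(nx); each conjugate pair takes the share
    e^(-2x) of this factor, the root 1 the share e^(-x). *)
Lemma csinh2_multiple M x : csinh2 (x * (nod M)%:R) = csinh2 x *
  \prod_(k < M) (csinh2 x ^+ 2 + (s2 M k)%:C).
Proof.
have pz := @zeta_prim (nod M) isT.
pose Y := cexp (- x); pose t := cexp x ^+ 2.
have XY : cexp x * Y = 1 by rewrite mulrC cexpNM.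
have tY : t * Y = cexp x by rewrite /t expr2 -mulrA XY mulr1.
have -> : csinh2 (x * (nod M)%:R) = (t ^+ nod M - 1) * Y ^+ nod M.
  by rewrite mulrBl -exprMn tY mul1r /csinh2 -mulNr !cexp_nat.
have := congr1 (fun p => p.[t]) (factor_Xn_sub_1 pz).
rewrite horner_prod hornerD hornerXn hornerN hornerC => <-.
under eq_bigr do rewrite hornerXsubC.
rewrite prod_fold_odd expr0.
have -> : Y ^+ nod M = Y * \prod_(k < M) Y ^+ 2.
  by rewrite prodr_const card_ord -exprM mul2n -exprS.
rewrite mulrACA -big_split /=; congr (_ * _); first by rewrite mulrBl tY mul1r.
apply: eq_bigr => k _; rewrite zeta_pair // rmorphB /= C2 /csinh2 -/Y.
have -> : (t ^+ 2 + 1 - (2 - (s2 M k)%:C) * t) * Y ^+ 2 =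
  (t * Y) ^+ 2 + Y ^+ 2 - (2 - (s2 M k)%:C) * (t * Y) * Y by ring.
rewrite tY -mulrA XY.
have -> : (cexp x - Y) ^+ 2 = cexp x ^+ 2 + Y ^+ 2 - 2 * (cexp x * Y) by ring.
by rewrite XY; ring.
Qed.


Let s2E M k : (s2 M k)%:C = - csinh2 (0 +i* (pi * k.+1%:R / (nod M)%:R)) ^+ 2 :> R[i].
Proof.
rewrite /csinh2 (_ : - (0 +i* _) = 0 +i* (- (pi * k.+1%:R / (nod M)%:R))); last first.
  by apply/eqP; rewrite eq_complex /= oppr0 !eqxx.
rewrite -!/(cis _) !cisE cosN sinN /s2.
by apply/eqP; rewrite eq_complex /= !expr2; apply/andP; split; apply/eqP => /=; ring.
Qed.

(** From sin b >= b/4 at b = pi (k+1)/n, which is at most pi/2 < 2 because k < M. It makes the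
    domination in the sine product independent of M. *)
Let s2_lb M k : (k < M)%N -> k.+1%:R ^+ 2 / (nod M)%:R ^+ 2 <= s2 M k.
Proof.
move=> kM; have n0 : 0 < (nod M)%:R :> R by rewrite ltr0n.
have k0 : 0 < k.+1%:R :> R by rewrite ltr0n.
have p2 := pi_ge2 R; have pl := pihalf_lt2 R.
have kn : 2 * (k.+1%:R / (nod M)%:R) <= 1 :> R.
  by rewrite mulrA ler_pdivrMr // mul1r -natrM ler_nat /nod; lia.
have q0 : 0 < k.+1%:R / (nod M)%:R :> R by rewrite divr_gt0.
rewrite -expr_div_n /s2 -mulrA; move: (_ / _) q0 kn => q q0 kn.
have h : pi * q / 4 <= sin (pi * q) by apply: sin_lower_bound; apply/andP; split; nra.
have h2 : q / 2 <= sin (pi * q) by nra.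
nra.
Qed.

(** Tannery's argument. With n = 2M+1, the number csinh2 x is n csinh2(x/n) times the product of 1 +
    csinh2(x/n)^2 / [s2] over k < M, for every M. Each factor has a limit as M grows, and a bound
    independent of M permits the exchange; the diagonal sequence is constant. *)
Lemma sine_product x :
  ctends (fun K => 2 * x * \prod_(k < K) (1 + x ^+ 2 / ((pi * k.+1%:R) ^+ 2)%:C)) (csinh2 x).
Proof.
pose f M K := (nod M)%:R * csinh2 (x / (nod M)%:R) *
  \prod_(k < K) (1 + csinh2 (x / (nod M)%:R) ^+ 2 / (s2 M k)%:C).
have lim1 (y : R[i]) : ctends (fun M => (nod M)%:R * csinh2 (y / (nod M)%:R)) (2 * y).
  apply: (@ctends_subseq _ (fun n => n.+1%:R * csinh2 (y / n.+1%:R)) _ double 0).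
    by move=> n; rewrite addn0 -addnn leq_addr.
  exact: ctends_csinh2.
have [B B0 hB] := ctends_bounded (lim1 x).
have nz M : (nod M)%:R != 0 :> R[i] by rewrite pnatr_eq0.
have s20 M k : (k < M)%N -> 0 < s2 M k.
  by move/s2_lb; apply: lt_le_trans; rewrite divr_gt0 ?exprn_gt0 ?ltr0n.
(* Combines |csinh2(x/n)| <= B/n, where B bounds a convergent sequence, with [s2] >= ((k+1)/n)^2 and
   1/(k+1)^2 <= 2 [weight k]. *)
have bound M k : (k < M)%N ->
    cabs (csinh2 (x / (nod M)%:R) ^+ 2 / (s2 M k)%:C) <= 2 * B ^+ 2 * weight k.
  move=> kM; have h := s2_lb kM; have k0 : 0 < k.+1%:R :> R by rewrite ltr0n.
  have n0 : 0 < (nod M)%:R :> R by rewrite ltr0n.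
  rewrite cabsM cabsV cabsX cabs_real gtr0_norm ?s20 // ler_pdivrMr ?s20 //.
  have hb := hB M; rewrite cabsM cabs_nat mulrC -ler_pdivlMr // in hb.
  have {}hb : cabs (csinh2 (x / (nod M)%:R)) ^+ 2 <= (B / (nod M)%:R) ^+ 2.
    by rewrite lerXn2r ?nnegrE ?cabs_ge0 // divr_ge0 ?ltW.
  rewrite (le_trans hb) //.
  have w0 : k.+1%:R ^- 2 <= 2 * weight k :> R.
    have k1 : 1 <= k.+1%:R :> R by rewrite ler1n.
    rewrite /weight -[k.+2%:R]natr1; move: (k.+1%:R) k0 k1 => q q0 q1.
    rewrite (_ : 2 * (q * (q + 1))^-1 = (q * (q + 1) / 2)^-1); last first.
      by field; rewrite !gt_eqF //; lra.
    have q2 : 0 < q * (q + 1) / 2 by nra.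
    by rewrite ler_pV2 ?inE ?unitfE ?(gt_eqF q2) ?q2 ?gt_eqF ?exprn_gt0 //; nra.
  rewrite (_ : (B / _) ^+ 2 = B ^+ 2 * (k.+1%:R ^- 2 * (k.+1%:R ^+ 2 / (nod M)%:R ^+ 2))).
    have -> : 2 * B ^+ 2 * weight k * s2 M k = B ^+ 2 * (2 * weight k * s2 M k) by ring.
    rewrite ler_wpM2l ?sqr_ge0 // ler_pM //.
      by rewrite invr_ge0 exprn_ge0 // ltW.
    by rewrite divr_ge0 ?exprn_ge0 // ltW.
  by rewrite mulKf ?expr_div_n // expf_neq0 // gt_eqF.
have fM M : f M M = csinh2 x.
  rewrite -[x in RHS](@divfK _ (nod M)%:R) // csinh2_multiple /f -prod_s2 mulrAC mulrC.
  rewrite -big_split /=; congr (_ * _); apply: eq_bigr => k _.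
  rewrite mulrDr mulr1 mulrC divfK 1?addrC //.
  by rewrite (_ : 0 = 0%:C) // (inj_eq (@complexI R)) gt_eqF // s20.
have := @ctends_interchange R (fun=> csinh2 x) f
  (fun K => 2 * x * \prod_(k < K) (1 + x ^+ 2 / ((pi * k.+1%:R) ^+ 2)%:C))
  (B * (expR (2 * B ^+ 2) * (2 * B ^+ 2 * expR (2 * B ^+ 2)))) (csinh2 x).
case.
- move=> K; apply: ctendsM; first exact: lim1.
  apply: ctends_prod => k; apply: ctendsD; first exact: ctends_cst.
  pose y : R[i] := 0 +i* (pi * k.+1%:R).
  have y0 : y != 0.
    by rewrite eq_complex /= eqxx mulf_neq0 ?pnatr_eq0 // gt_eqF ?pi_gt0.
  have yE M : (s2 M k)%:C = - csinh2 (y / (nod M)%:R) ^+ 2.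
    rewrite s2E; congr (- csinh2 _ ^+ 2); rewrite /y.
    rewrite -(rmorph_nat (real_complex R)) -fmorphV.
    by apply/eqP; rewrite eq_complex /=; apply/andP; split; apply/eqP; ring.
  have y2 : ((pi * k.+1%:R) ^+ 2)%:C = - y ^+ 2.
    by apply/eqP; rewrite eq_complex /= !expr2 /=; apply/andP; split; apply/eqP; ring.
  rewrite y2.
  apply: (@eq_ctends _ (fun M => - ((nod M)%:R * csinh2 (x / (nod M)%:R)) ^+ 2 *
    (((nod M)%:R * csinh2 (y / (nod M)%:R)) ^+ 2)^-1)).
    move=> M; rewrite yE !exprMn invfM mulNr mulrACA divff ?expf_neq0 // mul1r.
    by rewrite invrN mulrN.
  rewrite (_ : x ^+ 2 / - y ^+ 2 = - (2 * x) ^+ 2 * ((2 * y) ^+ 2)^-1); last by field.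
  apply: ctendsM; first by apply: ctendsN; apply: ctendsX; apply: lim1.
  apply: ctendsV; first by rewrite expf_neq0 // mulf_neq0 // pnatr_eq0.
  by apply: ctendsX; apply: lim1.
- move=> K M KM; rewrite -(fM M) /f -mulrBr cabsM -mulrA ler_pM ?cabs_ge0 //.
  apply: (@dominated_prod_diff _ (fun k => csinh2 (x / (nod M)%:R) ^+ 2 / (s2 M k)%:C)) => //.
    by rewrite mulr_ge0 ?sqr_ge0.
  by move=> k; apply: bound.
- by move=> _ h; apply: h; apply: ctends_cst.
Qed.

End SineProduct.

(** * Sums over boxes of integers *)

Section IntBox.

Lemma mem_int_box N (i : int) : (i \in int_box N) = (`|i| <= N)%N.
Proof.
apply/mapP/idP => [[k]|iN]; first by rewrite mem_iota => /andP[_ kN] ->; lia.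
by exists (absz (i + N%:Z)); rewrite ?mem_iota; lia.
Qed.

Lemma int_box_uniq N : uniq (int_box N).
Proof. by rewrite map_inj_uniq ?iota_uniq // => i j; lia. Qed.

Lemma big_int_box (T : Type) (idx : T) (op : Monoid.com_law idx) (f : int -> T) N :
  \big[op/idx]_(i <- int_box N) f i =
  op (f 0) (\big[op/idx]_(k < N) op (f k.+1%:Z) (f (- k.+1%:Z))).
Proof.
have h : perm_eq (int_box N)
    (0 :: [seq k%:Z | k <- iota 1 N] ++ [seq - k%:Z | k <- iota 1 N]).
  apply: uniq_perm; first exact: int_box_uniq.
    rewrite /= mem_cat negb_or cat_uniq !map_inj_uniq ?iota_uniq /=; last 2 first.
    - by move=> i j; lia.
    - by move=> i j; lia.
    rewrite andbT; apply/andP; split.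
      by apply/andP; split; apply/mapP => -[k]; rewrite mem_iota; lia.
    by apply/hasPn => i /mapP[k]; rewrite mem_iota => kN ->; apply/mapP => -[j]; rewrite mem_iota; lia.
  move=> i; rewrite mem_int_box inE mem_cat; apply/idP/idP => [iN|].
    have [e0|/= i0] := eqVneq i 0; [by [] | apply/orP].
    case: (lerP 0 i) => i1; [left | right]; apply/mapP; exists `|i|%N; rewrite ?mem_iota; lia.
  by case/or3P => [/eqP->//|/mapP[k]|/mapP[k]]; rewrite mem_iota; lia.
rewrite (perm_big _ h) big_cons big_cat !big_map big_split; congr (op _ (op _ _)).
  by rewrite -[RHS](big_mkord xpredT (fun k => f k.+1%:Z)) /index_iota subn0 -[1%N]addn0 iotaDl big_map.
by rewrite -[RHS](big_mkord xpredT (fun k => f (- k.+1%:Z))) /index_iota subn0 -[1%N]addn0 iotaDl big_map.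
Qed.

Lemma big_int_box_opp (T : Type) (idx : T) (op : Monoid.com_law idx) (f : int -> T) N :
  \big[op/idx]_(i <- int_box N) f (- i) = \big[op/idx]_(i <- int_box N) f i.
Proof.
rewrite !big_int_box oppr0; congr (op _ _); apply: eq_bigr => k _.
by rewrite opprK Monoid.mulmC.
Qed.

Lemma sum_subseq_le (R : numDomainType) (T : eqType) (s t : seq T) (f : T -> R) :
  uniq s -> uniq t -> {subset s <= t} -> (forall x, 0 <= f x) ->
  \sum_(x <- s) f x <= \sum_(x <- t) f x.
Proof.
move=> us ut st f0.
have h : perm_eq s [seq x <- t | x \in s].
  apply: uniq_perm; rewrite ?filter_uniq // => x; rewrite mem_filter.
  by case xs : (x \in s); rewrite //= st.
by rewrite (perm_big _ h) big_filter big_mkcond ler_sum // => x _; case: ifP.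
Qed.

Lemma big_split_sub (A : Type) (idx : A) (op : Monoid.com_law idx) (T : eqType)
    (s t : seq T) (f : T -> A) : uniq s -> uniq t -> {subset t <= s} ->
  \big[op/idx]_(x <- s) f x =
  op (\big[op/idx]_(x <- t) f x) (\big[op/idx]_(x <- s | x \notin t) f x).
Proof.
move=> us ut ts.
have h : perm_eq [seq x <- s | x \in t] t.
  apply: uniq_perm; rewrite ?filter_uniq // => x; rewrite mem_filter.
  by case xt : (x \in t); rewrite //= ts.
by rewrite (bigID [in t]) /= -[X in op X _ = _]big_filter (perm_big _ h).
Qed.

Lemma sum_split_sub (V : zmodType) (T : eqType) (s t : seq T) (f : T -> V) :
  uniq s -> uniq t -> {subset t <= s} ->
  \sum_(x <- s) f x - \sum_(x <- t) f x = \sum_(x <- s | x \notin t) f x.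
Proof. by move=> us ut ts; rewrite (big_split_sub _ _ us ut ts) /= [LHS]addrC addKr. Qed.

End IntBox.

(** * Dominated series over boxes *)

Section DominatedSums.
Context {R : realType}.

Let w (i : int) : R := weight `|i|%N.

Lemma weight_decr k : weight k.+1 <= weight k :> R.
Proof.
by rewrite /weight lef_pV2 ?posrE ?mulr_gt0 ?ltr0n // -!natrM ler_nat; lia.
Qed.

Lemma weight_box_tail K M : (K <= M)%N ->
  \sum_(i <- int_box M) w i - \sum_(i <- int_box K) w i <= 2 / K.+1%:R.
Proof.
move=> KM; rewrite !big_int_box /= -!(big_mkord xpredT (fun k => w k.+1%:Z + w (- k.+1%:Z))).
rewrite (big_cat_nat (leq0n K) KM) /=.
rewrite (_ : forall x y z : R, x + (y + z) - (x + y) = z); last by move=> *; ring.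
apply: (@le_trans _ _ (2 * \sum_(K <= k < M) weight k)); last first.
  by rewrite ler_wpM2l // weight_tail_le.
rewrite mulr_sumr ler_sum // => k _; rewrite /w abszN /= mulr2n mulrDl mul1r.
by rewrite lerD // weight_decr.
Qed.

Lemma weight_box_le M : \sum_(i <- int_box M) w i <= 3.
Proof.
have := weight_box_tail (leq0n M); rewrite divr1 (_ : int_box 0 = [:: 0]) //.
rewrite big_seq1 /w /weight /= mul1r; have : (2%:R : R)^-1 <= 1 by rewrite invf_le1 ?ler1n.
lra.
Qed.

Lemma weight_box_ge0 M : 0 <= \sum_(i <- int_box M) w i.
Proof. by apply: sumr_ge0 => i _; apply: weight_ge0. Qed.

Lemma dominated_box_tail (t : int -> R[i]) (C : R) K M : 0 <= C -> (K <= M)%N ->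
  (forall i, cabs (t i) <= C * w i) ->
  cabs (\sum_(i <- int_box M) t i - \sum_(i <- int_box K) t i) <= 2 * C / K.+1%:R.
Proof.
move=> C0 KM ht; rewrite !big_int_box /= -!(big_mkord xpredT (fun k => t k.+1%:Z + t (- k.+1%:Z))).
rewrite (big_cat_nat (leq0n K) KM) /=.
rewrite (_ : forall x y z : R[i], x + (y + z) - (x + y) = z); last by move=> *; ring.
rewrite (le_trans (cabs_sum _ _ _)) //.
apply: (@le_trans _ _ (2 * C * \sum_(K <= k < M) weight k)); last first.
  by rewrite ler_wpM2l ?mulr_ge0 // weight_tail_le.
rewrite mulr_sumr ler_sum // => k _; rewrite (le_trans (cabsD _ _)) //.
have h1 := ht k.+1%:Z; have h2 := ht (- k.+1%:Z); have h3 := weight_decr k.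
rewrite /w abszN /= in h1 h2; have := ler_wpM2l C0 h3; lra.
Qed.

Lemma dominated_box_cvg (t : int -> R[i]) (C : R) : 0 <= C ->
  (forall i, cabs (t i) <= C * w i) ->
  exists l, ctends (fun N => \sum_(i <- int_box N) t i) l.
Proof.
move=> C0 ht.
have [] := @ctends_cauchy _ (fun N => \sum_(i <- int_box N) t i) (2 * C).
  by move=> n k nk; apply: dominated_box_tail.
by move=> l hl _; exists l.
Qed.

Definition box2 N : seq (int * int) := [seq (i, j) | i <- int_box N, j <- int_box N].
Arguments box2 : simpl never.

Lemma box2_uniq N : uniq (box2 N).
Proof. by apply: allpairs_uniq; rewrite ?int_box_uniq // => -[? ?] [? ?]. Qed.

Lemma mem_box2 N (x : int * int) : (x \in box2 N) = (`|x.1| <= N)%N && (`|x.2| <= N)%N.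
Proof.
case: x => i j /=; apply/allpairsP/idP => [[[a b] /= [+ + [-> ->]]]|].
  by rewrite !mem_int_box => -> ->.
by move=> /andP[hi hj]; exists (i, j); rewrite !mem_int_box.
Qed.

(** Absolute convergence in finite form: an index set of any shape that contains the box N gives
    nearly the same sum. The constant 12 is 2 times 6, from b^2 - a^2 with b - a <= 2/(N+1) and a +
    b <= 6. *)
Lemma dominated_sum_seq (G : int * int -> R[i]) (C : R) N (s : seq (int * int)) : 0 <= C ->
  (forall x, cabs (G x) <= C * (w x.1 * w x.2)) -> uniq s -> {subset box2 N <= s} ->
  cabs (\sum_(x <- s) G x - \sum_(x <- box2 N) G x) <= 12 * C / N.+1%:R.
Proof.
move=> C0 hG us core.
have [M NM sM] : exists2 M, (N <= M)%N & {subset s <= box2 M}.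
  exists (N + \max_(x <- s) (`|x.1| + `|x.2|))%N; first exact: leq_addr.
  move=> [a b] xs; rewrite mem_box2 /=.
  have /= := @leq_bigmax_seq _ s xpredT (fun x : int * int => (`|x.1| + `|x.2|)%N) (a, b) xs isT.
  by move: (\max_(x <- s) _)%N => m; lia.
rewrite sum_split_sub ?box2_uniq // (le_trans (cabs_sum _ _ _)) //.
pose g x := if x \in box2 N then 0 else C * (w x.1 * w x.2).
have g0 x : 0 <= g x by rewrite /g; case: ifP => // _; rewrite !mulr_ge0 ?weight_ge0.
apply: (@le_trans _ _ (\sum_(x <- s) g x)).
  by rewrite big_mkcond ler_sum // => x _; rewrite /g if_neg; case: ifP.
rewrite (le_trans (sum_subseq_le us (box2_uniq M) sM g0)) //.
have W N' : \sum_(x <- box2 N') C * (w x.1 * w x.2) = C * (\sum_(i <- int_box N') w i) ^+ 2.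
  rewrite -mulr_sumr big_allpairs /= expr2 mulr_suml; congr (_ * _).
  by apply: eq_bigr => i _; rewrite mulr_sumr.
have -> : \sum_(x <- box2 M) g x = C * (\sum_(i <- int_box M) w i) ^+ 2 - C * (\sum_(i <- int_box N) w i) ^+ 2.
  rewrite -!W sum_split_sub ?box2_uniq //; last by move=> x; rewrite !mem_box2; lia.
  by rewrite [RHS]big_mkcond; apply: eq_bigr => x _; rewrite /g if_neg.
have := weight_box_tail NM; have := weight_box_le M; have := weight_box_le N.
have := weight_box_ge0 M; have := weight_box_ge0 N.
set a := \sum_(_ <- int_box N) _; set b := \sum_(_ <- int_box M) _ => a0 b0 a3 b3 ab.
rewrite -mulrBr subr_sqr (_ : 12 * C / N.+1%:R = C * (2 / N.+1%:R * 6)); last by ring.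
rewrite ler_wpM2l //.
have : 0 <= 2 / N.+1%:R :> R by rewrite divr_ge0 // ler0n.
move: (2 / _) ab => e ab e0; nra.
Qed.

(* The pairs (j, k) with j + k even, resp. odd, are (a + b, a - b), resp.
   (a + b, a - b + 1). *)
Lemma double_sum_parity (G : int -> int -> R[i]) (C : R) : 0 <= C ->
  (forall j k, cabs (G j k) <= C * (w j * w k)) ->
  ctends (fun N => \sum_(j <- int_box N.+1) \sum_(k <- int_box N.+1) G j k -
    (\sum_(a <- int_box N.+1) \sum_(b <- int_box N.+1) G (a + b) (a - b) +
     \sum_(a <- int_box N.+1) \sum_(b <- int_box N.+1) G (a + b) (a - b + 1))) 0.
Proof.
move=> C0 hG; apply: (@ctends_le _ _ _ (24 * C)) => N; rewrite subr0.
(* The change of variables does not map boxes to boxes, so the set of images and the box N+1 are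
   each compared with the box N; hence 24 = 12 + 12. *)
pose s := [seq (x.1 + x.2, x.1 - x.2) | x <- box2 N.+1] ++
          [seq (x.1 + x.2, x.1 - x.2 + 1) | x <- box2 N.+1].
have us : uniq s.
  rewrite cat_uniq !map_inj_uniq ?box2_uniq; last 2 first.
  - by move=> [a b] [a' b'] /= [h1 h2]; congr pair; lia.
  - by move=> [a b] [a' b'] /= [h1 h2]; congr pair; lia.
  rewrite andTb andbT; apply/hasPn => x /mapP[[a b] _ ->]; apply/mapP => -[[a' b'] _ /= []].
  by lia.
have core : {subset box2 N <= s}.
  move=> [j k]; rewrite mem_box2 /= => /andP[hj hk]; rewrite mem_cat; apply/orP.
  have [[a b] [[ja kb]|[ja kb]]] : exists x : int * int,
      (j = x.1 + x.2 /\ k = x.1 - x.2) \/ (j = x.1 + x.2 /\ k = x.1 - x.2 + 1).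
  - have [e|e] : (j + k = 2 * ((j + k) %/ 2)%Z) \/ (j + k = 2 * ((j + k) %/ 2)%Z + 1) by lia.
      by exists (((j + k) %/ 2)%Z, j - ((j + k) %/ 2)%Z) => /=; left; split; lia.
    by exists (((j + k) %/ 2)%Z, j - ((j + k) %/ 2)%Z) => /=; right; split; lia.
  - left; apply/mapP; exists (a, b); last by rewrite ja kb.
    by rewrite mem_box2 /=; simpl in *; lia.
  - right; apply/mapP; exists (a, b); last by rewrite ja kb.
    by rewrite mem_box2 /=; simpl in *; lia.
have hG' x : cabs (G x.1 x.2) <= C * (w x.1 * w x.2) by [].
have h1 := @dominated_sum_seq (fun x => G x.1 x.2) C N _ C0 hG' us core.
have h2 : cabs (\sum_(x <- box2 N.+1) G x.1 x.2 - \sum_(x <- box2 N) G x.1 x.2) <=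
    12 * C / N.+1%:R.
  by apply: dominated_sum_seq; rewrite ?box2_uniq // => x; rewrite !mem_box2; lia.
rewrite big_cat !big_map /= !big_allpairs /= in h1; rewrite !big_allpairs /= in h2.
rewrite cabsC in h1; apply: le_trans (le_trans (cabs_dist3 _ _ _) (lerD h2 h1)) _.
by rewrite (_ : 24 * C / N.+1%:R = 12 * C / N.+1%:R + 12 * C / N.+1%:R) //; ring.
Qed.

End DominatedSums.

(** * The theta series *)

Section ThetaSeries.
Context {R : realType}.
Variable dl : R.
Hypothesis dl0 : 0 < dl.
Implicit Types x y z t : R[i].

(** As i^2 - i = (i - 1/2)^2 - 1/4, this is, up to a constant factor, the general term of Jacobi's
    theta_1 with nome e^(-dl), with e^x in the role of e^(iz). *)
Definition theta_term x (i : int) : R[i] :=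
  (-1) ^ i * cexp (- dl%:C * (i ^+ 2 - i)%:~R + (2 * i - 1)%:~R * x).

(** Up to constant factors, [evenA] and [evenB] are the general terms of theta_2 and theta_3 with
    the nome squared and the argument doubled. *)
Let evenA x (a : int) : R[i] :=
  cexp (- dl%:C * (2 * a ^+ 2 - 2 * a)%:~R + (4 * a - 2)%:~R * x).

Let evenB x (b : int) : R[i] := cexp (- dl%:C * (2 * b ^+ 2)%:~R + (4 * b)%:~R * x).

Let signrz_even (a : int) : (-1) ^ (a + a) = 1 :> R[i].
Proof. by rewrite expfzDr ?oppr_eq0 ?oner_eq0 // -expfzMl mulrNN mulr1 exp1rz. Qed.

Lemma theta_term_even x y a b :
  theta_term (x + y) (a + b) * theta_term (x - y) (a - b) = evenA x a * evenB y b.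
Proof.
rewrite /theta_term /evenA /evenB mulrACA -expfzDr ?oppr_eq0 ?oner_eq0 //.
rewrite addrACA subrr addr0 signrz_even mul1r -!cexpD; congr cexp; ring.
Qed.

Lemma theta_term_odd x y a b :
  theta_term (x + y) (a + b) * theta_term (x - y) (a - b + 1) = - (evenB x a * evenA y b).
Proof.
rewrite /theta_term /evenA /evenB mulrACA -expfzDr ?oppr_eq0 ?oner_eq0 //.
rewrite (_ : a + b + _ = (a + a) + 1); last by ring.
rewrite expfzDr ?oppr_eq0 ?oner_eq0 // signrz_even mul1r expr1z mulN1r -!cexpD.
by congr (- cexp _); ring.
Qed.

(** The factors n+1 and n+2 of the inverse weight are at most e^n and 2 e^n, which raises the linear
    coefficient from r to r + 2; completing the square then gives the constant. *)
Lemma gaussian_dominated (s r r0 : R) : 0 < s -> exists2 C : R, 0 <= C &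
  forall n : nat, forall e : R, e <= - s * n%:R ^+ 2 + r * n%:R + r0 -> expR e <= C * weight n.
Proof.
move=> s0; exists (2 * expR ((r + 2) ^+ 2 / (4 * s) + r0)) => [|n e he].
  by rewrite mulr_ge0 ?expR_ge0.
have n0 : 0 <= n%:R :> R by rewrite ler0n.
have e1 := expR_ge1Dx (n%:R : R).
rewrite /weight ler_pdivlMr ?mulr_gt0 ?ltr0n // -![n.+2%:R]natr1 -[n.+1%:R]natr1.
apply: (@le_trans _ _ (expR e * (expR n%:R * (2 * expR n%:R)))).
  by rewrite ler_wpM2l ?expR_ge0 // ler_pM //; lra.
rewrite mulrCA mulrA [_ * (2 * _)]mulrCA -!mulrA ler_wpM2l // -!expRD ler_expR.
have h : 0 <= s * (n%:R - (r + 2) / (2 * s)) ^+ 2 by rewrite mulr_ge0 ?sqr_ge0 // ltW.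
have : s * (n%:R - (r + 2) / (2 * s)) ^+ 2 =
    s * n%:R ^+ 2 - (r + 2) * n%:R + (r + 2) ^+ 2 / (4 * s) by field; rewrite gt_eqF.
lra.
Qed.

Lemma cabs_signrz (i : int) : cabs ((-1) ^ i : R[i]) = 1.
Proof. by case: i => n; rewrite ?NegzE -?exprnN ?cabsV ?cabsX cabsN cabs1 expr1n ?invr1. Qed.

Let norm_intr (i : int) : `|i%:~R| = `|i|%N%:R :> R.
Proof. by rewrite -intr_norm -abszE. Qed.

Let Re_exponent (s : R) (m k : int) x :
  complex.Re (- s%:C * m%:~R + k%:~R * x) = - s * m%:~R + k%:~R * complex.Re x.
Proof.
rewrite -!(rmorph_int (real_complex R)); case: x => a b /=; ring.
Qed.

(** The three shapes of [m] are, in this order, the exponents of [evenA], [theta_term] and [evenB];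
    all are at least |i|^2 - 2|i|. *)
Lemma quadratic_dominated (s : R) (c : int) x : 0 < s ->
  exists2 C : R, 0 <= C & forall (i m k : int), m = c * i ^+ 2 - 2 * i \/ m = c * i ^+ 2 - i \/
    m = c * i ^+ 2 ->
    (`|k| <= 4 * `|i| + 2)%N -> 0 < c ->
    cabs (cexp (- s%:C * m%:~R + k%:~R * x)) <= C * weight `|i|%N.
Proof.
move=> s0.
have [C C0 hC] := @gaussian_dominated s (2 * s + 4 * `|complex.Re x|) (2 * `|complex.Re x|) s0.
exists C => // i m k hm hk c0; rewrite cabs_cexp; apply: hC; rewrite Re_exponent.
have hx := ler_norm (k%:~R * complex.Re x); rewrite normrM norm_intr in hx.
have x0 := normr_ge0 (complex.Re x).
have {}hx : k%:~R * complex.Re x <= (4 * `|i|%N%:R + 2) * `|complex.Re x|.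
  rewrite (le_trans hx) // ler_wpM2r // -(natrM _ 4) -(natrD _ _ 2) ler_nat.
  exact: hk.
have im : `|i|%N%:Z * `|i|%N%:Z - 2 * `|i|%N%:Z <= m by nia.
have {}im : `|i|%N%:R ^+ 2 - 2 * `|i|%N%:R <= m%:~R :> R.
  by rewrite -(ler_int R) rmorphB !rmorphM /= in im; rewrite expr2.
have h : s * (`|i|%N%:R ^+ 2 - 2 * `|i|%N%:R) <= s * m%:~R by rewrite ler_wpM2l // ltW.
lra.
Qed.

Lemma theta_term_dominated x : exists2 C : R, 0 <= C &
  forall i, cabs (theta_term x i) <= C * weight `|i|%N.
Proof.
have [C C0 hC] := @quadratic_dominated dl 1 x dl0; exists C => // i.
rewrite cabsM cabs_signrz mul1r; apply: hC => //; last by lia.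
by right; left; rewrite mul1r.
Qed.

Let evenA_dominated x : exists2 C : R, 0 <= C &
  forall i, cabs (evenA x i) <= C * weight `|i|%N.
Proof.
have [C C0 hC] := @quadratic_dominated dl 2 x dl0; exists C => // i.
by apply: hC => //; [left | lia].
Qed.

Let evenB_dominated x : exists2 C : R, 0 <= C &
  forall i, cabs (evenB x i) <= C * weight `|i|%N.
Proof.
have [C C0 hC] := @quadratic_dominated dl 2 x dl0; exists C => // i.
by apply: hC => //; [right; right | lia].
Qed.

Let box_cvg (f : R[i] -> int -> R[i]) :
  (forall x, exists2 C : R, 0 <= C & forall i, cabs (f x i) <= C * weight `|i|%N) ->
  exists F : R[i] -> R[i], forall x, ctends (fun N => \sum_(i <- int_box N) f x i) (F x).
Proof.
move=> h; have ex x : exists l, ctends (fun N => \sum_(i <- int_box N) f x i) l.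
  by have [C C0 hC] := h x; apply: dominated_box_cvg C0 hC.
by have [F hF] := choice ex; exists F.
Qed.

Lemma theta_series : exists2 T : R[i] -> R[i],
  (forall x, ctends (fun N => \sum_(i <- int_box N) theta_term x i) (T x)) &
  (forall x y z t, three_term T x y z t = 0).
Proof.
have [T hT] := box_cvg theta_term_dominated.
have [A hA] := box_cvg evenA_dominated.
have [B hB] := box_cvg evenB_dominated.
exists T => //.
have TE x y : T (x + y) * T (x - y) = A x * B y - B x * A y.
  have [C1 C10 h1] := theta_term_dominated (x + y).
  have [C2 C20 h2] := theta_term_dominated (x - y).
  have dom j k : cabs (theta_term (x + y) j * theta_term (x - y) k) <=
      C1 * C2 * (weight `|j|%N * weight `|k|%N) by rewrite cabsM mulrACA ler_pM ?cabs_ge0.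
  have lim0 := double_sum_parity (mulr_ge0 C10 C20) dom.
  have sh (f : R[i] -> int -> R[i]) F u :
      (forall u, ctends (fun N => \sum_(i <- int_box N) f u i) (F u)) ->
      ctends (fun N => \sum_(i <- int_box N.+1) f u i) (F u).
    by move=> h; apply: (ctends_subseq (f := S) (c := 0)) (h u) => n; rewrite addn0.
  apply/eqP; rewrite -subr_eq0; apply/eqP; apply: (ctends_uniq _ lim0).
  apply: (@eq_ctends _ (fun N =>
    (\sum_(i <- int_box N.+1) theta_term (x + y) i) * (\sum_(i <- int_box N.+1) theta_term (x - y) i) -
    ((\sum_(i <- int_box N.+1) evenA x i) * (\sum_(i <- int_box N.+1) evenB y i) -
     (\sum_(i <- int_box N.+1) evenB x i) * (\sum_(i <- int_box N.+1) evenA y i)))).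
    move=> N; congr (_ - (_ + _)).
    - by rewrite mulr_suml; apply: eq_bigr => i _; rewrite mulr_sumr.
    - rewrite mulr_suml; apply: eq_bigr => i _; rewrite mulr_sumr.
      by apply: eq_bigr => j _; rewrite theta_term_even.
    - rewrite mulr_suml -sumrN; apply: eq_bigr => i _; rewrite mulr_sumr -sumrN.
      by apply: eq_bigr => j _; rewrite theta_term_odd.
  by apply: ctendsB; [|apply: ctendsB]; apply: ctendsM; apply: sh.
(* With [xy] for the minor A(x)B(y) - B(x)A(y), the claim is [xy][zt] + [yz][xt] + [zx][yt] = 0. *)
move=> x y z t; rewrite /three_term -[_ * _ * T (z + t) * _]mulrA -[_ * _ * T (x + t) * _]mulrA.
rewrite -[_ * _ * T (y + t) * _]mulrA !TE; ring.
Qed.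

End ThetaSeries.

(** * The triple product *)

Section GaussBinomial.
Context {F : fieldType}.
Variable p : F.
Hypothesis p_gen : forall k, p ^+ k.+1 != 1.

Definition qpoch n : F := \prod_(k < n) (1 - p ^+ k.+1).

Lemma qpoch0 : qpoch 0 = 1. Proof. by rewrite /qpoch big_ord0. Qed.

Lemma qpochS n : qpoch n.+1 = qpoch n * (1 - p ^+ n.+1).
Proof. by rewrite /qpoch big_ord_recr. Qed.

Lemma qpoch_neq0 n : qpoch n != 0.
Proof. by apply/prodf_neq0 => k _; rewrite subr_eq0 eq_sym. Qed.

Definition qbinom (n j : nat) : F :=
  if (j <= n)%N then qpoch n / (qpoch j * qpoch (n - j)) else 0.

Lemma qbinomS n j : qbinom n.+1 j.+1 = p ^+ j.+1 * qbinom n j.+1 + qbinom n j.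
Proof.
rewrite /qbinom ltnS subSS; have [jn|nj|->] := ltngtP j n; last 2 first.
- by rewrite mulr0 addr0.
- by rewrite mulr0 add0r subnn qpoch0 !mulr1 !divff ?qpoch_neq0.
have := qpoch_neq0; have nz m : 1 - p ^+ m.+1 != 0 by rewrite subr_eq0 eq_sym.
rewrite (_ : (n - j = (n - j.+1).+1)%N); last by lia.
rewrite (_ : qpoch n.+1 = qpoch n * (1 - p ^+ j.+1 * p ^+ (n - j.+1).+1)); last first.
  by rewrite qpochS -exprD; congr (_ * (1 - p ^+ _)); lia.
rewrite !qpochS; have h1 := nz j; have h2 := nz (n - j.+1)%N.
move: (p ^+ j.+1) (p ^+ _.+1) h1 h2 => u v h1 h2 q0.
by field; rewrite !q0 h1 h2.
Qed.

Lemma qbinom0 n : qbinom n 0 = 1.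
Proof. by rewrite /qbinom subn0 qpoch0 mul1r divff // qpoch_neq0. Qed.

(** The induction removes the factor k = 0 and uses the hypothesis at x p; comparing coefficients is
    the Pascal rule [qbinomS]. *)
Lemma q_binomial_theorem n x :
  \prod_(k < n) (1 - x * p ^+ k) =
  \sum_(j < n.+1) (-1) ^+ j * p ^+ 'C(j, 2) * qbinom n j * x ^+ j.
Proof.
elim: n x => [|n IH] x.
  by rewrite big_ord0 big_ord1 !expr0 qbinom0 !mulr1.
rewrite big_ord_recl expr0 mulr1.
under eq_bigr do rewrite exprS mulrA.
rewrite IH mulrBl mul1r [RHS]big_ord_recl /= !expr0 qbinom0 !mulr1.
transitivity (\sum_(j < n.+2) (-1) ^+ j * p ^+ 'C(j, 2) * (p ^+ j * qbinom n j) * x ^+ j -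
   x * \sum_(i < n.+1) (-1) ^+ i * p ^+ 'C(i, 2) * qbinom n i * (x * p) ^+ i).
  congr (_ - _); rewrite [RHS]big_ord_recr /= /qbinom ltnn !mulr0 mul0r addr0.
  by apply: eq_bigr => j _; rewrite exprMn; ring.
rewrite big_ord_recl /= !expr0 qbinom0 !mulr1 -addrA; congr (_ + _).
rewrite mulr_sumr -sumrB; apply: eq_bigr => j _.
rewrite /bump /= !add1n qbinomS binS bin1 exprD exprMn !exprS; ring.
Qed.

End GaussBinomial.

(** * The truncated theta product and its limit *)

Section ThetaProduct.
Context {R : realType}.
Variable dl : R.
Hypothesis dl0 : 0 < dl.
Implicit Types x : R[i].

(** The limit is nonzero because some tail stays within 1/2 of 1, so that later partial products
    keep at least half the modulus reached before that tail. *)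
Lemma dominated_prod_cvg (a : nat -> R[i]) (C : R) : 0 <= C ->
  (forall k, cabs (a k) <= C * weight k) -> (forall k, 1 + a k != 0) ->
  exists2 l, ctends (fun n => \prod_(k < n) (1 + a k)) l & l != 0.
Proof.
move=> C0 ha a0.
have [] := @ctends_cauchy _ (fun n => \prod_(k < n) (1 + a k)) (expR C * (C * expR C)).
  by move=> n k nk; apply: dominated_prod_diff.
move=> l hl _; exists l => //.
have [N hN] := @small_inv R (C * expR C) 2^-1 ltac:(by rewrite invr_gt0).
have : cabs (\prod_(k < N) (1 + a k)) / 2 <= cabs l.
  apply: (ctends_lb (N := N) hl) => n Nn.
  rewrite (prod_nat_split (fun k => 1 + a k) Nn) cabsM ler_wpM2l ?cabs_ge0 //.
  have h := @dominated_prod_tail R a C N n C0 Nn (fun k _ => ha k).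
  have h2 := hN N (leqnn N).
  have := cabs_lbD 1 (\prod_(N <= k < n) (1 + a k) - 1).
  rewrite cabs1 (addrC 1 (_ - 1)) subrK; move: (C * _ / _) h h2 => e h h2; lra.
rewrite -cabs_gt0; apply: lt_le_trans; rewrite divr_gt0 // cabs_gt0.
exact/prodf_neq0.
Qed.

Lemma exp_dominated (s : R) : 0 < s -> exists2 C : R, 0 <= C &
  forall k : nat, expR (- (s * k.+1%:R)) <= C * weight k.
Proof.
move=> s0; exists (4 / s ^+ 2) => [|k]; first by rewrite divr_ge0 ?sqr_ge0.
have k0 : 0 < k.+1%:R :> R by rewrite ltr0n.
have k1 : 1 <= k.+1%:R :> R by rewrite ler1n.
have h := @expR_ge1Dxn R (s * k.+1%:R) 1 (mulr_ge0 (ltW s0) (ltW k0)).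
rewrite expRN /weight -[k.+2%:R]natr1; move: (k.+1%:R) k0 k1 h => q q0 q1.
rewrite (_ : 2`!%:R = 2) // => h.
have e0 := expR_gt0 (s * q).
have s2 : 0 < s ^+ 2 by rewrite exprn_gt0.
have q2 : 0 < s ^+ 2 * (q * (q + 1)) / 4 by rewrite divr_gt0 // !mulr_gt0 //; lra.
rewrite (_ : 4 / s ^+ 2 / (q * (q + 1)) = (s ^+ 2 * (q * (q + 1)) / 4)^-1); last first.
  by field; rewrite !gt_eqF //; lra.
rewrite lef_pV2 ?posrE // (le_trans _ h) // exprMn ler_wpDl //.
have : q * (q + 1) <= 2 * q ^+ 2 by nra.
by move=> hq; have := ler_wpM2l (ltW s2) hq; lra.
Qed.

(** The base of the q-series is the square of the nome e^(-dl). *)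
Let p : R[i] := cexp (- (2 * dl)%:C).

Let pX n : p ^+ n = cexp (- (2 * dl * n%:R)%:C).
Proof. by rewrite /p -cexp_nat mulNr !rmorphM !rmorph_nat. Qed.

Let cabs_pX n : cabs (p ^+ n) = expR (- (2 * dl * n%:R)).
Proof. by rewrite pX cabs_cexp /=. Qed.

Let p_gen k : p ^+ k.+1 != 1.
Proof.
apply/eqP => /(congr1 cabs); rewrite cabs_pX cabs1 => /eqP; rewrite lt_eqF //.
by rewrite -[ltRHS]expR0 ltr_expR oppr_lt0 !mulr_gt0 ?ltr0n.
Qed.

Let shift x (i : int) := x - dl%:C * i%:~R.

Let box_ord (f : int -> R[i]) K :
  \prod_(i <- int_box K) f i = \prod_(k < K.*2.+1) f (k%:Z - K%:Z).
Proof. by rewrite /int_box big_map -(big_mkord xpredT (fun k => f (k%:Z - K%:Z))) /index_iota subn0. Qed.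

Let bin2_double j : 2 * 'C(j, 2)%:R = j%:R ^+ 2 - j%:R :> R[i].
Proof.
elim: j => [|j IH]; first by rewrite mulr0 expr0n subrr.
by rewrite binS bin1 natrD mulrDr IH; ring.
Qed.

(** The finite form of Jacobi's triple product. By 1 - e^(2u) = - e^u csinh2 u, the left-hand side
    is, up to exponentials, a q-binomial product at e^(2(x + K dl)); the shifts by dl i cancel in
    pairs, so these exponentials amount to e^((2K+1)x). *)
Lemma csinh2_box_expand K x : \prod_(i <- int_box K) csinh2 (shift x i) =
  - (-1) ^+ K * cexp (dl%:C * (K ^ 2 + K)%:R) *
  \sum_(j < K.*2.+2) qbinom p K.*2.+1 j * theta_term dl x (j%:Z - K%:Z).
Proof.
have one_sub u : 1 - cexp (2 * u) = - cexp u * csinh2 u.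
  rewrite /csinh2 mulrBr !mulNr -!cexpD subrr cexp0 opprK [RHS]addrC.
  by congr (_ - cexp _); ring.
have sum0 : \sum_(k < K.*2.+1) shift x (k%:Z - K%:Z) = (K.*2.+1)%:R * x.
  rewrite sumrB sumr_const card_ord -mulr_sumr -[RHS]subr0 mulr_natl; congr (_ - _).
  apply/eqP; rewrite mulf_eq0; apply/orP; right; apply/eqP.
  have h := big_int_box_opp (GRing.add : Monoid.com_law (0 : R[i])) (fun i => i%:~R) K.
  rewrite /= (eq_bigr (fun i => - i%:~R)) in h; last by move=> i _; rewrite rmorphN.
  rewrite sumrN in h; rewrite -(big_mkord xpredT (fun k => (k%:Z - K%:Z)%:~R : R[i])) /index_iota subn0.
  rewrite -(big_map (fun k => k%:Z - K%:Z) xpredT (fun i => i%:~R)) -/(int_box K).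
  move/eqP: h; rewrite eq_sym -subr_eq0 opprK -mulr2n mulrn_eq0 => /eqP; exact.
have E : \prod_(k < K.*2.+1) (1 - cexp (2 * (x + dl%:C * K%:R)) * p ^+ k) =
    - cexp ((K.*2.+1)%:R * x) * \prod_(i <- int_box K) csinh2 (shift x i).
  rewrite box_ord -sum0 cexp_sum.
  rewrite (_ : - _ = \prod_(k < K.*2.+1) (- cexp (shift x (k%:Z - K%:Z)))); last first.
    by rewrite prodrN card_ord -signr_odd /= odd_double expr1 mulN1r.
  rewrite -big_split; apply: eq_bigr => k _ /=; rewrite -one_sub pX -cexpD.
  by congr (1 - cexp _); rewrite /shift !rmorphM !rmorph_nat; ring.
apply: (@mulfI _ (- cexp ((K.*2.+1)%:R * x))); first by rewrite oppr_eq0 cexp_neq0.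
rewrite -E q_binomial_theorem // !mulr_sumr; apply: eq_bigr => j _.
rewrite pX -cexp_nat /theta_term.
have -> : (-1) ^+ j = (-1) ^+ K * (-1) ^ (j%:Z - K%:Z) :> R[i].
  by rewrite -[(-1) ^+ K]/((-1) ^ K%:Z) -expfzDr ?oppr_eq0 ?oner_eq0 // addrC subrK.
move: ((-1) ^+ K) ((-1) ^ _) (qbinom _ _ _) => s1 s2 b.
transitivity (s1 * s2 * b * (cexp (- (2 * dl * 'C(j, 2)%:R)%:C) *
    cexp (2 * (x + dl%:C * K%:R) * j%:R))); first by ring.
set e1 := cexp (_ * x); set e2 := cexp (dl%:C * _); set e3 := cexp (_ + _).
transitivity (s1 * s2 * b * (e1 * e2 * e3)); last by ring.
congr (_ * _); rewrite /e1 /e2 /e3 -!cexpD; congr cexp.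
rewrite !rmorphM !rmorph_nat (_ : 2 * dl%:C * 'C(j, 2)%:R = dl%:C * (2 * 'C(j, 2)%:R)); last by ring.
rewrite bin2_double natrD natrX (_ : K.*2.+1%:R = 2 * K%:R + 1); last first.
  by rewrite -natr1 -mul2n natrM.
ring.
Qed.


(** The division by csinh2(dl k)^2 is the one that arises in [poly_box_limit] from the factors 1 -
    z^2/l^2, each equal to 1 at z = 0. *)
Definition theta_prod K x : R[i] := csinh2 x * \prod_(k < K)
  (csinh2 ((dl * k.+1%:R)%:C - x) * csinh2 ((dl * k.+1%:R)%:C + x) /
   csinh2 (dl * k.+1%:R)%:C ^+ 2).

Lemma theta_prodE K x : theta_prod K x = - (qpoch p K)^-1 ^+ 2 *
  \sum_(j < K.*2.+2) qbinom p K.*2.+1 j * theta_term dl x (j%:Z - K%:Z).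
Proof.
(* The normalising product contributes e^(dl (K^2 + K)), which cancels against [csinh2_box_expand],
   and the square of the q-Pochhammer product. *)
have den : \prod_(k < K) csinh2 (dl * k.+1%:R)%:C ^+ 2 =
    cexp (dl%:C * (K ^ 2 + K)%:R) * qpoch p K ^+ 2.
  elim: K => [|K IH]; first by rewrite big_ord0 mulr0 cexp0 qpoch0 expr1n mulr1.
  rewrite big_ord_recr /= IH qpochS pX.
  have -> : csinh2 (dl * K.+1%:R)%:C =
      cexp (dl * K.+1%:R)%:C * (1 - cexp (- (2 * dl * K.+1%:R)%:C)).
    rewrite /csinh2 mulrBr mulr1 -cexpD; congr (_ - cexp _).
    by rewrite !rmorphM !rmorph_nat; ring.
  rewrite (_ : cexp (dl%:C * (K.+1 ^ 2 + K.+1)%:R) =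
    cexp (dl%:C * (K ^ 2 + K)%:R) * cexp (dl * K.+1%:R)%:C ^+ 2); first by ring.
  rewrite expr2 -!cexpD; congr cexp.
  by rewrite !rmorphM !rmorph_nat !natrD !natrX -!natr1; ring.
have := csinh2_box_expand K x; rewrite big_int_box /= /shift mulr0 subr0.
under eq_bigr => k _.
  rewrite rmorphN mulrN opprK (_ : x - dl%:C * _ = - ((dl * k.+1%:R)%:C - x)); last first.
    by rewrite rmorphM rmorph_nat; ring.
  rewrite csinh2N mulNr (_ : x + dl%:C * _ = (dl * k.+1%:R)%:C + x); last first.
    by rewrite rmorphM rmorph_nat; ring.
  over.
rewrite prodrN card_ord => E.
rewrite /theta_prod big_split /= prodfV den mulrA.
have s0 : (-1) ^+ K * (-1) ^+ K = 1 :> R[i] by rewrite -expr2 sqrr_sign.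
have E0 : cexp (dl%:C * (K ^ 2 + K)%:R) != 0 by apply: cexp_neq0.
have q0 := qpoch_neq0 p_gen K.
move: (csinh2 x) (\prod_(_ < K) _) E => u v E.
have -> : u * v = - cexp (dl%:C * (K ^ 2 + K)%:R) *
    \sum_(j < K.*2.+2) qbinom p K.*2.+1 j * theta_term dl x (j%:Z - K%:Z).
  move: ((-1) ^+ K) s0 E => s s0 E.
  transitivity ((s * s) * (u * v)); first by rewrite s0 mul1r.
  transitivity (s * (u * (s * v))); first by ring.
  rewrite E; transitivity (- (s * s) * cexp (dl%:C * (K ^ 2 + K)%:R) *
    \sum_(j < K.*2.+2) qbinom p K.*2.+1 j * theta_term dl x (j%:Z - K%:Z)); first by ring.
  by rewrite s0 mulN1r.
by field; rewrite E0 q0.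
Qed.

Lemma theta_prod_limit : exists2 T : R[i] -> R[i],
  (forall x y z t, three_term T x y z t = 0) &
  exists c, forall x, ctends (theta_prod^~ x) (c * T x).
Proof.
have [T hT T3] := theta_series dl0; exists T => //.
have d2 : 0 < 2 * dl by rewrite mulr_gt0.
have [C1 C10 hC1] := exp_dominated d2.
have dom k : cabs (- p ^+ k.+1) <= C1 * weight k by rewrite cabsN cabs_pX.
have nz k : 1 + - p ^+ k.+1 != 0 by rewrite subr_eq0 eq_sym p_gen.
have [P hP P0] := dominated_prod_cvg C10 dom nz.
have [B1 B10 hB1] := ctends_bounded hP.
have hV := ctendsV P0 hP; have [B2 B20 hB2] := ctends_bounded hV.
have hq n : qpoch p n = \prod_(k < n) (1 + - p ^+ k.+1) by [].
(* The coefficients indexed by i = j - M. Their range, from -M to M+1, is not symmetric; the value 0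
   at i = -M-1 completes it to the box M+1. *)
pose bc M (i : int) : R[i] := if 0 <= M%:Z + i then qbinom p M.*2.+1 (absz (M%:Z + i)%R) else 0.
have bc_bound M i : cabs (bc M i) <= B1 * (B2 * B2).
  have z0 : 0 <= B1 * (B2 * B2) by rewrite !mulr_ge0 // ltW.
  rewrite /bc; case: ifP => _; last by rewrite cabs0.
  rewrite /qbinom; case: ifP => _; last by rewrite cabs0.
  by rewrite invfM !cabsM !ler_pM ?mulr_ge0 ?cabs_ge0 // !hq.
(* At fixed i both indices below tend to infinity with M, so the q-binomial coefficient tends to P /
   P^2. With the uniform bound above, the limit can then be taken inside the theta series. *)
have bc_lim i : ctends (fun M => bc M i) P^-1.
  have lim : ctends (fun M => qpoch p M.*2.+1 * ((qpoch p (absz (M%:Z + i)%R))^-1 *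
      (qpoch p (M.*2.+1 - (absz (M%:Z + i)%R)))^-1)) P^-1.
    rewrite -[P^-1](mulVKf P0); apply: ctendsM.
      by apply: (@ctends_subseq _ (qpoch p) _ (fun M => M.*2.+1) 0) => [n|//]; lia.
    apply: ctendsM.
      by apply: (@ctends_subseq _ (fun n => (qpoch p n)^-1) _ _ `|i|) => [n|//]; lia.
    by apply: (@ctends_subseq _ (fun n => (qpoch p n)^-1) _ _ `|i|) => [n|//]; lia.
  move=> e /lim [N hN]; exists (maxn N `|i|.+1) => M; rewrite geq_max => /andP[NM iM].
  have := hN M NM; rewrite /bc ifT; last by lia.
  by rewrite /qbinom ifT ?invfM //; lia.
exists (- (P^-1) ^+ 2 * P^-1) => x.
have [C C0 hC] := theta_term_dominated dl0 x.
apply: (@eq_ctends _ (fun K => - (qpoch p K)^-1 ^+ 2 * \sum_(i <- int_box K.+1) bc K i * theta_term dl x i)).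
  move=> K; rewrite theta_prodE; congr (_ * _).
  rewrite /int_box big_map -(big_mkord xpredT (fun j => qbinom p _ j * theta_term dl x (j%:Z - K%:Z))).
  have iotaS n : iota 0 n.+1 = 0%N :: [seq k.+1 | k <- iota 0 n].
    by rewrite /= -[1%N]addn0 iotaDl.
  rewrite iotaS doubleS big_cons /bc ifF ?mul0r ?add0r; last by lia.
  rewrite big_map /index_iota subn0; apply: eq_bigr => k _.
  rewrite ifT; last by lia.
  by congr (qbinom _ _ _ * theta_term _ _ _); lia.
rewrite -mulrA; apply: ctendsM; first by apply/ctendsN/ctendsX.
apply/(@ctends_interchange _ _ (fun M K => \sum_(i <- int_box K) bc M i * theta_term dl x i)
  (fun K => P^-1 * \sum_(i <- int_box K) theta_term dl x i) (2 * (B1 * (B2 * B2) * C))).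
- move=> K; rewrite mulr_sumr; apply: ctends_sum => i.
  by apply: ctendsM (bc_lim i) (ctends_cst _).
- move=> K M KM; apply: (@dominated_box_tail _ (fun i => bc M i * theta_term dl x i)).
  + by rewrite !mulr_ge0 // ltW.
  + exact: leqW.
  + by move=> i; rewrite cabsM -mulrA ler_pM ?cabs_ge0.
- exact: ctendsZ.
Qed.

End ThetaProduct.

(** * The sigma function *)

Section SigmaProduct.
Context {R : realType}.
Variables om1 eta : R.
Hypothesis om1_gt0 : 0 < om1.
Hypothesis eta_gt0 : 0 < eta.
Implicit Types z : R[i].

Let o1 : R[i] := om1%:C.
Let o3 : R[i] := 0 +i* eta.
Let l (x : int * int) : R[i] := lattice_pt o1 o3 x.1 x.2.
Let w (i : int) : R := weight `|i|%N.

(* One representative of each pair of opposite nonzero lattice points. *)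
Definition half_box (K M : nat) : seq (int * int) :=
  [seq (0, k.+1%:Z) | k <- iota 0 M] ++
  [seq (j.+1%:Z, n) | j <- iota 0 K, n <- int_box M].

Lemma big_half_box (T : Type) (idx : T) (op : Monoid.com_law idx) (f : int * int -> T) K M :
  \big[op/idx]_(x <- half_box K M) f x =
  op (\big[op/idx]_(k < M) f (0, k.+1%:Z))
     (\big[op/idx]_(j < K) \big[op/idx]_(n <- int_box M) f (j.+1%:Z, n)).
Proof.
rewrite /half_box big_cat big_map big_allpairs_dep; congr (op _ _).
  by rewrite -[RHS](big_mkord xpredT (fun k => f (0, k.+1%:Z))) /index_iota subn0.
by rewrite -[RHS](big_mkord xpredT (fun j => \big[op/idx]_(n <- int_box M) f (j.+1%:Z, n)))
  /index_iota subn0.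
Qed.

Lemma mem_half_box K M (x : int * int) : (x \in half_box K M) =
  ((x.1 == 0) && (0 < x.2 <= M%:Z)) || ((0 < x.1 <= K%:Z) && (`|x.2| <= M)%N).
Proof.
case: x => a b; rewrite [(a, b).1]/= [(a, b).2]/= mem_cat; congr (_ || _).
  apply/mapP/idP => [[k]|/andP[/eqP -> bM]]; first by rewrite mem_iota => kM [-> ->]; lia.
  by exists (absz b).-1; rewrite ?mem_iota; [|congr pair]; lia.
apply/allpairsPdep/idP => [[j [n [+ + [-> ->]]]]|/andP[aK bM]].
  by rewrite mem_int_box mem_iota; lia.
exists (absz a).-1, b; rewrite mem_int_box mem_iota /=; split; [lia | lia | congr pair; lia].
Qed.

Lemma half_box_uniq K M : uniq (half_box K M).
Proof.
rewrite cat_uniq map_inj_uniq ?iota_uniq; last by move=> i j []; lia.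
apply/and3P; split => //.
  apply/hasPn => x /allpairsPdep[j [n [_ _ ->]]]; apply/mapP => -[k _ []]; lia.
apply: allpairs_uniq; rewrite ?iota_uniq ?int_box_uniq // => -[j n] [j' n'] _ _ /= [].
by move=> h ->; congr pair; lia.
Qed.

(** At v = z^2/l^2 this is the product of the Weierstrass factors of l and -l, in whose exponents
    the odd terms z/l cancel. *)
Definition even_factor (v : R[i]) : R[i] := (1 - v) * cexp v.

Definition sigma_box z K M : R[i] := z * \prod_(x <- half_box K M) even_factor (z ^+ 2 / l x ^+ 2).

Lemma sigma_partial_box z N : sigma_partial o1 o3 z N = sigma_box z N N.
Proof.
have pair m n : weierstrass_factor z (lattice_pt o1 o3 m n) *
    weierstrass_factor z (lattice_pt o1 o3 (- m) (- n)) = even_factor (z ^+ 2 / l (m, n) ^+ 2).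
  rewrite /weierstrass_factor (_ : lattice_pt o1 o3 (- m) (- n) = - l (m, n)); last first.
    by rewrite /l /lattice_pt /=; ring.
  rewrite -/(l (m, n)) /even_factor mulrACA -cexpD !expr2 !invfM invrN.
  move: (l _)^-1 => r; congr (_ * cexp _); first by ring.
  by have h2 : (2 : R[i]) != 0; [rewrite pnatr_eq0 | field].
rewrite /sigma_partial /sigma_box; congr (_ * _).
rewrite big_int_box big_half_box /=; congr (_ * _).
  rewrite big_mkcond big_int_box /= mul1r; apply: eq_bigr => k _.
  by rewrite -pair oppr0.
apply: eq_bigr => j _.
rewrite [X in _ * X = _]big_mkcond -(big_int_box_opp (GRing.mul : Monoid.com_law (1 : R[i])) _ N) /=.
rewrite -[RHS](big_int_box_opp (GRing.mul : Monoid.com_law (1 : R[i]))) /=.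
by rewrite big_mkcond -big_split /=; apply: eq_bigr => n _; rewrite -pair opprK.
Qed.

Let mu : R := 4 * Num.min om1 eta ^+ 2.

Let mu_gt0 : 0 < mu.
Proof. by rewrite mulr_gt0 // exprn_gt0 // lt_min om1_gt0. Qed.

Let d2 (x : int * int) : R := x.1%:~R ^+ 2 + x.2%:~R ^+ 2.

Let min_sqr_le : Num.min om1 eta ^+ 2 <= om1 ^+ 2 /\ Num.min om1 eta ^+ 2 <= eta ^+ 2.
Proof.
have m0 : 0 < Num.min om1 eta by rewrite lt_min om1_gt0.
have h1 : Num.min om1 eta <= om1 by rewrite ge_min lexx.
have h2 : Num.min om1 eta <= eta by rewrite ge_min lexx orbT.
by split; nra.
Qed.

Let lE a b : 2 * o1 * a%:C + o3 * b%:C = (2 * om1 * a) +i* (eta * b).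
Proof. by apply/eqP; rewrite eq_complex /=; apply/andP; split; apply/eqP; ring. Qed.

Let l_pair x : l x = (2 * om1 * x.1%:~R) +i* (eta * (2 * x.2%:~R)).
Proof.
by rewrite -lE /l /lattice_pt rmorphM !rmorph_int rmorph_nat; ring.
Qed.

Let l_lb x : mu * d2 x <= cabs (l x) ^+ 2.
Proof.
rewrite cabs_sqr l_pair /= /mu /d2; have [h1 h2] := min_sqr_le.
move: (x.1%:~R : R) (x.2%:~R : R) => a b; have := sqr_ge0 a; have := sqr_ge0 b.
move: (Num.min _ _ ^+ 2) h1 h2 => m; nra.
Qed.

Let d2_ge1 x : x != (0, 0) -> 1 <= d2 x.
Proof.
case: x => a b ab0; rewrite /d2 /= -!rmorphXn -rmorphD /= -[leLHS]/(1%:~R) ler_int.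
move: ab0; rewrite xpair_eqE; nia.
Qed.


Let norm_intr_sqr (a : int) : a%:~R ^+ 2 = `|a|%N%:R ^+ 2 :> R.
Proof. by rewrite natr_absz intr_norm real_normK ?num_real. Qed.

(** Turns a decay of order |l|^-4 into a product of one-dimensional weights, so that sums over
    rectangles factor; each of the two weights costs a factor 6. *)
Let weight_pair x : x != (0, 0) -> (d2 x ^+ 2)^-1 <= 36 * (w x.1 * w x.2).
Proof.
move=> x0; have h1 := d2_ge1 x0.
have key (m n : int) : (m, n) != (0, 0) ->
    (`|m|.+1%:R * `|m|.+2%:R <= 6 * (m%:~R ^+ 2 + n%:~R ^+ 2) :> R) *
    (`|n|.+1%:R * `|n|.+2%:R <= 6 * (m%:~R ^+ 2 + n%:~R ^+ 2) :> R).
  rewrite xpair_eqE => mn; rewrite !norm_intr_sqr -!natrX -natrD -!natrM !ler_nat.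
  by split; nia.
case: x x0 h1 => m n x0; rewrite /d2 /w /weight /= => h1.
have [k1 k2] := key m n x0; move: (_ + _) h1 k1 k2 => d h1 k1 k2.
have pos (a b : nat) : 0 < a.+1%:R * b.+1%:R :> R by rewrite mulr_gt0 ?ltr0n.
move: (_ * _) (pos `|m|%N `|m|.+1) k1 => p p0 k1.
move: (_ * _) (pos `|n|%N `|n|.+1) k2 => q q0 k2.
have -> : 36 * (p^-1 * q^-1) = (p * q / 36)^-1 by field; rewrite !gt_eqF.
have pq : 0 < p * q / 36 by rewrite divr_gt0 // mulr_gt0.
rewrite lef_pV2 ?posrE ?exprn_gt0 //; last by lra.
rewrite ler_pdivrMr // expr2; nra.
Qed.

(** The linear terms of 1 - v and e^v cancel. With v of order |l|^-2 this leaves |l|^-4, which is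
    summable over the lattice. *)
Lemma even_factor_bound (B : R) : exists2 C : R, 0 <= C &
  forall v : R[i], cabs v <= B -> cabs (even_factor v - 1) <= C * cabs v ^+ 2.
Proof.
have [C C0 hC] := @cexp_taylor1 R B; exists (C * (1 + `|B|) + 1).
  by rewrite addr_ge0 // mulr_ge0 // addr_ge0.
move=> v vB; have h := hC v vB; have v0 := cabs_ge0 v; have B0 := le_trans v0 vB.
have -> : even_factor v - 1 = (cexp v - 1 - v) * (1 - v) - v ^+ 2 by rewrite /even_factor; ring.
rewrite (le_trans (cabsB _ _)) // cabsM cabsX mulrDl mul1r lerD2r (ger0_norm B0).
have h1 : cabs (1 - v) <= 1 + B by rewrite (le_trans (cabsB _ _)) // cabs1 lerD2l.
by rewrite mulrAC ler_pM ?cabs_ge0.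
Qed.

Let l_sqr_lb x : x != (0, 0) -> 0 < mu * d2 x /\ mu * d2 x <= cabs (l x ^+ 2).
Proof.
move=> x0; rewrite cabsX; split; last exact: l_lb.
by rewrite mulr_gt0 // (lt_le_trans ltr01) // d2_ge1.
Qed.

Let factor_dominated z : exists2 C : R, 0 <= C & forall x, x != (0, 0) ->
  cabs (even_factor (z ^+ 2 / l x ^+ 2) - 1) <= C * (w x.1 * w x.2).
Proof.
have [C C0 hC] := even_factor_bound (cabs z ^+ 2 / mu).
exists (C * ((cabs z ^+ 2 / mu) ^+ 2 * 36)).
  by rewrite mulr_ge0 // mulr_ge0 // sqr_ge0.
move=> x x0; have [m0 ml] := l_sqr_lb x0; have d1 := d2_ge1 x0.
have hv : cabs (z ^+ 2 / l x ^+ 2) <= cabs z ^+ 2 / mu * (d2 x)^-1.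
  rewrite cabsM cabsV cabsX -mulrA -invfM ler_wpM2l ?sqr_ge0 //.
  by rewrite lef_pV2 ?posrE // (lt_le_trans m0).
have B0 : 0 <= cabs z ^+ 2 / mu by rewrite divr_ge0 ?sqr_ge0 // ltW.
have hv2 : cabs (z ^+ 2 / l x ^+ 2) <= cabs z ^+ 2 / mu.
  by rewrite (le_trans hv) // ler_piMr // invf_le1 // (lt_le_trans ltr01).
rewrite (le_trans (hC _ hv2)) // -mulrA ler_wpM2l //.
apply: (@le_trans _ _ ((cabs z ^+ 2 / mu * (d2 x)^-1) ^+ 2)).
  by rewrite lerXn2r ?nnegrE ?cabs_ge0 // mulr_ge0 // invr_ge0 (le_trans ler01).
by rewrite exprMn exprVn -mulrA ler_wpM2l ?sqr_ge0 // weight_pair.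
Qed.

Let half_box_neq0 K M x : x \in half_box K M -> x != (0, 0).
Proof. by case: x => a b; rewrite mem_half_box xpair_eqE /=; lia. Qed.

Let sw M : R := \sum_(k < M) weight k.+1.

Let sw_tail K M : (K <= M)%N -> 0 <= sw K /\ sw K <= 1 /\ sw M - sw K <= K.+1%:R^-1.
Proof.
move=> KM; have le n m : \sum_(n <= k < m) weight k.+1 <= n.+1%:R^-1 :> R.
  by rewrite (le_trans _ (weight_tail_le n m)) // ler_sum // => k _; apply: weight_decr.
rewrite /sw -!(big_mkord xpredT (fun k => weight k.+1 : R)) (big_cat_nat (leq0n K) KM) /=.
have e (x y : R) : x + y - x = y by ring.
rewrite e; split; last by split; [have := le 0%N K; rewrite invr1 | exact: le].
by apply: sumr_ge0 => k _; apply: weight_ge0.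
Qed.

Let half_box_weight K M : \sum_(x <- half_box K M) w x.1 * w x.2 =
  w 0 * sw M + sw K * \sum_(n <- int_box M) w n.
Proof.
rewrite big_half_box /=; congr (_ + _); first by rewrite mulr_sumr.
by rewrite mulr_suml; apply: eq_bigr => j _; rewrite mulr_sumr.
Qed.

Let w0 : w 0 = 2^-1.
Proof. by rewrite /w /weight mul1r. Qed.

Let half_box_weight_le K M : \sum_(x <- half_box K M) w x.1 * w x.2 <= 4.
Proof.
rewrite half_box_weight w0.
have [a0 [a1 _]] := sw_tail (leqnn M); have [b0 [b1 _]] := sw_tail (leqnn K).
have := @weight_box_le R M; have := @weight_box_ge0 R M; rewrite -/w.
move: (\sum_(n <- _) _) => W; nra.
Qed.

Let half_box_weight_tail K M M' : (K <= M)%N -> (M <= M')%N ->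
  \sum_(x <- half_box M' M') w x.1 * w x.2 - \sum_(x <- half_box K M) w x.1 * w x.2 <=
  6 / K.+1%:R.
Proof.
move=> KM MM; rewrite !half_box_weight w0.
have [a0 [a1 a2]] := sw_tail MM; have [b0 [b1 b2]] := sw_tail (leq_trans KM MM).
have [c0 [c1 _]] := sw_tail (leqnn M').
have := @weight_box_le R M; have := @weight_box_ge0 R M.
have := weight_box_tail (R := R) MM; rewrite -/w.
have : M.+1%:R^-1 <= K.+1%:R^-1 :> R by rewrite lef_pV2 ?posrE ?ltr0n // ler_nat.
have : 0 <= M.+1%:R^-1 :> R by rewrite invr_ge0 ler0n.
move: (M.+1%:R^-1) (K.+1%:R^-1) (\sum_(n <- int_box M) _) (\sum_(n <- int_box M') _) a2 b2.
move=> m k W W' a2 b2 m0 mk t W0 W3.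
have : sw M' * (W' - W) <= 2 * k by nra.
have : (sw M' - sw K) * W <= 3 * k by nra.
lra.
Qed.

Let box_sub K M M' : (K <= M)%N -> (M <= M')%N -> {subset half_box K M <= half_box M' M'}.
Proof. by move=> KM MM [a b]; rewrite !mem_half_box /=; lia. Qed.

(** Stated as a ratio because it serves twice: with a bound on the products it gives the Cauchy
    property, and by itself the lower bound that keeps sigma from vanishing off the lattice. *)
Let sigma_box_ratio z : exists2 C : R, 0 <= C & forall K M M', (K <= M)%N -> (M <= M')%N ->
  exists2 r, sigma_box z M' M' = sigma_box z K M * r & cabs (r - 1) <= C / K.+1%:R.
Proof.
have [C C0 hC] := factor_dominated z.
exists (C * 6 * expR (C * 6)); first by rewrite !mulr_ge0 ?expR_ge0.
move=> K M M' KM MM; pose a x := even_factor (z ^+ 2 / l x ^+ 2) - 1.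
exists (\prod_(x <- half_box M' M' | x \notin half_box K M) (1 + a x)).
  rewrite /sigma_box (big_split_sub _ _ (half_box_uniq _ _) (half_box_uniq K M) (box_sub KM MM)).
  by rewrite /= mulrA; congr (_ * _); apply: eq_bigr => x _; rewrite /a addrC subrK.
have hs : \sum_(x <- half_box M' M' | x \notin half_box K M) cabs (a x) <= C * 6 / K.+1%:R.
  apply: (@le_trans _ _ (\sum_(x <- half_box M' M' | x \notin half_box K M) C * (w x.1 * w x.2))).
    rewrite big_seq_cond [leRHS]big_seq_cond; apply: ler_sum => x /andP[xh _].
    by apply: hC; apply: half_box_neq0 xh.
  rewrite -mulr_sumr -mulrA ler_wpM2l //.
  rewrite -(sum_split_sub _ (half_box_uniq _ _) (half_box_uniq K M) (box_sub KM MM)).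
  exact: half_box_weight_tail.
rewrite (le_trans (cabs_prod1D_le hs)) // mulrAC ler_wpM2r ?invr_ge0 ?ler0n //.
rewrite ler_wpM2l ?mulr_ge0 // ler_expR ler_pdivrMr ?ltr0n // ler_peMr ?mulr_ge0 //.
by rewrite ler1n.
Qed.

Let sigma_box_bounded z : exists2 C : R, 0 <= C & forall K M, cabs (sigma_box z K M) <= C.
Proof.
have [C C0 hC] := factor_dominated z.
exists (cabs z * expR (C * 4)); first by rewrite mulr_ge0 ?cabs_ge0 ?expR_ge0.
move=> K M; pose a x := even_factor (z ^+ 2 / l x ^+ 2) - 1.
rewrite /sigma_box cabsM ler_wpM2l ?cabs_ge0 //.
rewrite (eq_bigr (fun x => 1 + a x)) => [|x _]; last by rewrite /a addrC subrK.
have := cabs_prod1D (half_box K M) xpredT a.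
have hs : \sum_(x <- half_box K M) cabs (a x) <= C * 4.
  apply: (@le_trans _ _ (\sum_(x <- half_box K M) C * (w x.1 * w x.2))).
    rewrite big_seq_cond [leRHS]big_seq_cond; apply: ler_sum => x /andP[xh _].
    by apply: hC; apply: half_box_neq0 xh.
  by rewrite -mulr_sumr ler_wpM2l // half_box_weight_le.
rewrite -ler_expR in hs; have := cabsD (\prod_(x <- half_box K M) (1 + a x) - 1) 1.
rewrite subrK cabs1; lra.
Qed.

Let sigma_box_near z : exists C : R, exists2 S : R[i], ctends (sigma_partial o1 o3 z) S &
  forall K M, (K <= M)%N -> cabs (sigma_box z K M - S) <= C / K.+1%:R.
Proof.
have [C C0 hC] := sigma_box_ratio z; have [D D0 hD] := sigma_box_bounded z.
have diff K M M' : (K <= M)%N -> (M <= M')%N ->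
    cabs (sigma_box z M' M' - sigma_box z K M) <= D * C / K.+1%:R.
  move=> KM MM; have [r -> hr] := hC K M M' KM MM.
  have -> (u : R[i]) : u * r - u = u * (r - 1) by ring.
  by rewrite cabsM -mulrA ler_pM ?cabs_ge0.
have [] := @ctends_cauchy R (fun N => sigma_box z N N) (D * C).
  by move=> n k nk; apply: diff.
move=> S hS _; exists (D * C); exists S.
  by apply: eq_ctends hS => N; rewrite sigma_partial_box.
move=> K M KM; rewrite cabsC.
have hn := ctendsB hS (ctends_cst (sigma_box z K M)).
by apply: (ctends_ub (N := M) hn) => k Mk; apply: diff.
Qed.

Lemma sigma_cvg z : ctends (sigma_partial o1 o3 z) (sigma o1 o3 z).
Proof. by have [C [S hS _]] := sigma_box_near z; rewrite /sigma (ctends_climn hS). Qed.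

(** The error depends on K alone, for every M >= K: the rectangles may be elongated at will, as the
    two-stage limit requires. *)
Lemma sigma_box_cvg z : exists C : R, forall K M, (K <= M)%N ->
  cabs (sigma_box z K M - sigma o1 o3 z) <= C / K.+1%:R.
Proof.
have [C [S hS h]] := sigma_box_near z; exists C => K M KM.
by rewrite (ctends_uniq (sigma_cvg z) hS) h.
Qed.

Lemma sigmaN z : sigma o1 o3 (- z) = - sigma o1 o3 z.
Proof.
apply: ctends_uniq (sigma_cvg (- z)) _; apply: eq_ctends (ctendsN (sigma_cvg z)) => N.
by rewrite !sigma_partial_box /sigma_box sqrrN mulNr.
Qed.

Lemma sigma_neq0 z : ~ lattice o1 o3 z -> sigma o1 o3 z != 0.
Proof.
move=> zL; have [C C0 hC] := sigma_box_ratio z.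
have [N hN] := @small_inv R C 2^-1 ltac:(by rewrite invr_gt0).
have : cabs (sigma_box z N N) / 2 <= cabs (sigma o1 o3 z).
  apply: (ctends_lb (N := N) (sigma_cvg z)) => n Nn.
  rewrite sigma_partial_box; have [r -> hr] := hC N N n (leqnn N) Nn.
  rewrite cabsM ler_wpM2l ?cabs_ge0 //; have h2 := hN N (leqnn N).
  have := cabs_lbD 1 (r - 1); rewrite cabs1 (addrC 1 (r - 1)) subrK.
  move: (C / _) hr h2 => e hr h2; lra.
rewrite -cabs_gt0; apply: lt_le_trans; rewrite divr_gt0 // cabs_gt0.
have ne x : z != l x.
  by apply/eqP => zx; apply: zL; exists x.1, x.2.
have z0 : z != 0 by have := ne (0, 0); rewrite /l /lattice_pt /= !mulr0 addr0.
rewrite mulf_neq0 //; rewrite prodf_seq_neq0; apply/allP => x /half_box_neq0 x0 /=.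
rewrite mulf_neq0 ?cexp_neq0 // subr_eq0 eq_sym -expr_div_n sqrf_eq1 negb_or.
have l0 : l x != 0.
  by have [m0 ml] := l_sqr_lb x0; apply/eqP => e; move: m0 ml; rewrite e expr0n cabs0; lra.
apply/andP; split; apply/eqP => e.
  by have := ne x; rewrite -[z](divfK l0) e mul1r eqxx.
have := ne (- x.1, - x.2); rewrite -[z](divfK l0) e mulN1r (_ : l (_, _) = - l x) ?eqxx //.
by rewrite /l /lattice_pt /=; ring.
Qed.


(** * The Gaussian factor and its exponent *)

Let expo K M : R[i] := \sum_(x <- half_box K M) (l x ^+ 2)^-1.

Let poly_box z K M : R[i] := z * \prod_(x <- half_box K M) (1 - z ^+ 2 / l x ^+ 2).

Let sigma_box_expo z K M : sigma_box z K M = cexp (z ^+ 2 * expo K M) * poly_box z K M.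
Proof.
rewrite /sigma_box /poly_box mulrCA; congr (_ * _).
by rewrite /expo mulr_sumr cexp_sum -big_split /=; apply: eq_bigr => x _; rewrite /even_factor mulrC.
Qed.

(** For e = 1 and e = -1 these are the midpoints between l and its neighbours in the row. Since |2n
    + e| >= |n|, they satisfy the lower bound known for l with mu/4 in place of mu. *)
Let dist_half m n (e : R) : `|e| = 1 -> m != 0 ->
  mu / 4 * d2 (m, n) <= cabs (l (m, n) + o3 * e%:C) ^+ 2 /\
  l (m, n) + o3 * e%:C = (2 * om1 * m%:~R) +i* (eta * (2 * n%:~R + e)).
Proof.
move=> e1 m0; have E : l (m, n) + o3 * e%:C = (2 * om1 * m%:~R) +i* (eta * (2 * n%:~R + e)).
  by rewrite l_pair /=; apply/eqP; rewrite eq_complex /=; apply/andP; split; apply/eqP; ring.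
split => //; rewrite cabs_sqr E /= /mu /d2 /=; have [h1 h2] := min_sqr_le.
have q : n%:~R ^+ 2 <= (2 * n%:~R + e) ^+ 2 :> R.
  have n2 : `|n%:~R| <= n%:~R ^+ 2 :> R.
    by rewrite norm_intr_sqr -intr_norm -abszE -[_%:~R]/(`|n|%N%:R) -natrX ler_nat; nia.
  have e2 : e ^+ 2 = 1 by rewrite -[e ^+ 2](ger0_norm (sqr_ge0 _)) normrX e1 expr1n.
  have ne : - `|n%:~R| <= n%:~R * e.
    by have := ler_norm (- (n%:~R * e)); rewrite normrN normrM e1 mulr1; lra.
  nra.
move: (m%:~R : R) (n%:~R : R) q => u v q.
have m0' : 0 <= Num.min om1 eta ^+ 2 by apply: sqr_ge0.
have t1 : Num.min om1 eta ^+ 2 * v ^+ 2 <= eta ^+ 2 * (2 * v + e) ^+ 2.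
  by rewrite ler_pM ?sqr_ge0.
have t2 : Num.min om1 eta ^+ 2 * u ^+ 2 <= om1 ^+ 2 * u ^+ 2 by rewrite ler_wpM2r ?sqr_ge0.
have t3 : 0 <= om1 ^+ 2 * u ^+ 2 by rewrite mulr_ge0 ?sqr_ge0.
rewrite !exprMn; move: (Num.min _ _ ^+ 2) t1 t2 => k t1 t2; lra.
Qed.

(** Absolute values would give a divergent sum, so cancellation along rows is used: 1/(l^2 - o3^2)
    telescopes, because l + o3 is l' - o3 for the next point l'. The condition K <= M enters here:
    each of the K rows leaves end terms of order 1/(M+1). *)
Let expo_bounded : exists B : R, forall K M, (K <= M)%N -> cabs (expo K M) <= B.
Proof.
(* In this order: the half row m = 0, the end terms of the other rows, the remainders. The factor
   144 is 4 from [dist_half] times 36 from [weight_pair], and the last 4 bounds the weights of a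
   half box. *)
exists (2 / mu + (1 / eta ^+ 2 + 144 * eta ^+ 2 / mu ^+ 2 * 4)) => K M KM.
rewrite /expo big_half_box (le_trans (cabsD _ _)) // lerD //.
  rewrite (le_trans (cabs_sum _ _ _)) //.
  apply: (@le_trans _ _ (\sum_(k < M) 2 / mu * weight k)); last first.
    by rewrite -mulr_sumr ler_piMr ?weight_sum_le // divr_ge0 // ltW.
  apply: ler_sum => k _; have k0 : ((0, k.+1%:Z) : (int * int)%type) != (0, 0) by [].
  have [m0 ml] := l_sqr_lb k0.
  rewrite cabsV (@le_trans _ _ (mu * d2 (0, k.+1%:Z))^-1) //.
    by rewrite lef_pV2 ?posrE // (lt_le_trans m0).
  rewrite /d2 /= expr0n add0r /weight -[k.+2%:R]natr1 -pmulrn.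
  have q1 : 1 <= k.+1%:R :> R by rewrite ler1n.
  move: (k.+1%:R) q1 => q q1.
  rewrite (_ : 2 / mu / (q * (q + 1)) = (mu * (q * (q + 1) / 2))^-1); last first.
    by field; rewrite !gt_eqF //; lra.
  have A0 : 0 < mu * (q * (q + 1) / 2) by rewrite mulr_gt0 //; nra.
  have B0 : 0 < mu * q ^+ 2 by rewrite mulr_gt0 //; nra.
  by rewrite lef_pV2 ?posrE // ler_wpM2l ?(ltW mu_gt0) //; nra.
(* On each row 1/l^2 is a telescoping term plus a remainder of order |l|^-4. *)
pose u j (n : int) : R[i] := (l (j.+1%:Z, n) - o3)^-1.
pose r x : R[i] := - (o3 ^+ 2 / (l x ^+ 2 * (l x ^+ 2 - o3 ^+ 2))).
have o30 : o3 != 0 by rewrite eq_complex /= eqxx gt_eqF.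
have lm j n : l (j.+1%:Z, n) - o3 = (2 * om1 * j.+1%:R) +i* (eta * (2 * n%:~R - 1)).
  have [_] := @dist_half j.+1%:Z n (-1) (normrN1 _) isT.
  by rewrite rmorphN1 mulrN1 => ->.
have lp j n : l (j.+1%:Z, n) + o3 = (2 * om1 * j.+1%:R) +i* (eta * (2 * n%:~R + 1)).
  have [_] := @dist_half j.+1%:Z n 1 (normr1 _) isT.
  by rewrite rmorph1 mulr1 => ->.
have nz (a b : R) : 0 < a -> a +i* b != 0 by move=> a0; rewrite eq_complex /= gt_eqF.
have j0 j : 0 < 2 * om1 * j.+1%:R by rewrite !mulr_gt0 ?ltr0n.
have step j n : (l (j.+1%:Z, n) ^+ 2)^-1 = (2 * o3)^-1 * (u j n - u j (n + 1)) + r (j.+1%:Z, n).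
  have -> : u j (n + 1) = (l (j.+1%:Z, n) + o3)^-1.
    by rewrite /u; congr (_^-1); rewrite /l /lattice_pt /=; ring.
  have n1 : l (j.+1%:Z, n) - o3 != 0 by rewrite lm nz.
  have n2 : l (j.+1%:Z, n) + o3 != 0 by rewrite lp nz.
  have n3 : l (j.+1%:Z, n) != 0 by rewrite l_pair nz //; apply: j0.
  have n4 : l (j.+1%:Z, n) ^+ 2 - o3 ^+ 2 != 0 by rewrite subr_sqr mulf_neq0.
  by rewrite /u /r; field; rewrite ?n1 ?n2 ?n3 ?n4 ?o30 ?pnatr_eq0.
under eq_bigr do under eq_bigr do rewrite step.
under eq_bigr do rewrite big_split /=.
rewrite big_split /= (le_trans (cabsD _ _)) // lerD //.
  rewrite (le_trans (cabs_sum _ _ _)) //.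
  apply: (@le_trans _ _ (\sum_(j < K) 1 / eta ^+ 2 / M.+1%:R)); last first.
    rewrite sumr_const card_ord -[_ *+ K]mulr_natr -[leLHS]mulrA ler_piMr ?divr_ge0 ?sqr_ge0 //.
    by rewrite mulrC ler_pdivrMr ?ltr0n // mul1r ler_nat leqW.
  apply: ler_sum => j _; rewrite -mulr_sumr.
  have -> : \sum_(n <- int_box M) (u j n - u j (n + 1)) = u j (- M%:Z) - u j (M%:Z + 1).
    rewrite /int_box big_map -[iota _ _]/(index_iota 0 M.*2.+1).
    rewrite (eq_bigr (fun k => - u j (k.+1%:Z - M%:Z) - - u j (k%:Z - M%:Z))).
      rewrite (telescope_sumr (fun k => - u j (k%:Z - M%:Z))) // opprK [LHS]addrC.
      by congr (u j _ - u j _); lia.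
    by move=> k _; rewrite opprK [RHS]addrC; congr (_ - u j _); lia.
  have ub (n : int) : (M.+1 <= absz (2 * n - 1)%R)%N -> cabs (u j n) <= (eta * M.+1%:R)^-1.
    move=> hn; rewrite /u cabsV lm; have c0 : 0 < cabs ((2 * om1 * j.+1%:R) +i* (eta * (2 * n%:~R - 1))).
      by rewrite cabs_gt0 nz.
    rewrite lef_pV2 ?posrE ?mulr_gt0 ?ltr0n //.
    apply: le_trans (Im_le_cabs _); rewrite /= normrM (gtr0_norm eta_gt0) ler_wpM2l ?(ltW eta_gt0) //.
    rewrite (_ : 2 * n%:~R - 1 = (2 * n - 1)%:~R); last by ring.
    by rewrite -intr_norm -abszE -[leRHS]/((absz (2 * n - 1)%R)%:R) ler_nat.
  rewrite cabsM cabsV (_ : cabs (2 * o3) = 2 * eta); last first.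
    by rewrite cabsM cabs_nat /cabs /o3 /= expr0n add0r sqrtr_sqr gtr0_norm.
  have h1 := ub (- M%:Z) ltac:(lia); have h2 := ub (M%:Z + 1) ltac:(lia).
  have -> : 1 / eta ^+ 2 / M.+1%:R = (2 * eta)^-1 * ((eta * M.+1%:R)^-1 + (eta * M.+1%:R)^-1).
    have M0 : 0 < M.+1%:R :> R by rewrite ltr0n.
    by move: (M.+1%:R) M0 => q q0; field; rewrite !gt_eqF.
  by rewrite ler_wpM2l ?invr_ge0 ?mulr_ge0 ?(ltW eta_gt0) // (le_trans (cabsB _ _)) // lerD.
rewrite (le_trans (cabs_sum _ _ _)) //.
apply: (@le_trans _ _ (\sum_(j < K) \sum_(n <- int_box M)
    144 * eta ^+ 2 / mu ^+ 2 * (w j.+1%:Z * w n))); last first.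
  have := half_box_weight_le K M; rewrite big_half_box /= => h.
  under eq_bigr do rewrite -mulr_sumr.
  have c0 : 0 <= 144 * eta ^+ 2 / mu ^+ 2.
    by apply: divr_ge0; [apply: mulr_ge0; rewrite ?sqr_ge0 | exact: sqr_ge0].
  rewrite -mulr_sumr ler_wpM2l //; apply: le_trans h.
  rewrite lerDr; apply: sumr_ge0 => k _; by rewrite mulr_ge0 ?weight_ge0.
apply: ler_sum => j _; rewrite (le_trans (cabs_sum _ _ _)) // ler_sum // => n _.
have x0 : (j.+1%:Z, n) != (0, 0) by rewrite xpair_eqE.
have [m0 ml] := l_sqr_lb x0; have d1 := d2_ge1 x0.
have [hp _] := @dist_half j.+1%:Z n 1 (normr1 _) isT.
have [hm _] := @dist_half j.+1%:Z n (-1) (normrN1 _) isT.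
rewrite rmorph1 mulr1 in hp; rewrite rmorphN1 mulrN1 in hm.
have wp := weight_pair x0; rewrite /= in wp.
rewrite /r cabsN cabsM cabsV [cabs (_ * (_ - _))]cabsM (_ : cabs (o3 ^+ 2) = eta ^+ 2); last first.
  by rewrite cabsX cabs_sqr /o3 /= expr0n add0r.
have h4 : mu / 4 * d2 (j.+1%:Z, n) <= cabs (l (j.+1%:Z, n) ^+ 2 - o3 ^+ 2).
  have p0 : 0 <= mu / 4 * d2 (j.+1%:Z, n).
    apply: mulr_ge0; last exact: le_trans d1.
    by rewrite divr_ge0 // ltW.
  have q0 : 0 <= cabs (l (j.+1%:Z, n) - o3) * cabs (l (j.+1%:Z, n) + o3).
    by rewrite mulr_ge0 ?cabs_ge0.
  rewrite subr_sqr cabsM -(@ler_pXn2r _ 2) // [leRHS]exprMn [leLHS]expr2.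
  exact: ler_pM.
have -> : 144 * eta ^+ 2 / mu ^+ 2 * (w j.+1%:Z * w n) =
  eta ^+ 2 * (4 / mu ^+ 2 * (36 * (w j.+1%:Z * w n))) by field; rewrite gt_eqF.
rewrite ler_wpM2l ?sqr_ge0 //.
apply: (@le_trans _ _ (4 / mu ^+ 2 * (d2 (j.+1%:Z, n) ^+ 2)^-1)); last first.
  by rewrite ler_wpM2l // divr_ge0 ?sqr_ge0.
have dd : 0 < d2 (j.+1%:Z, n) by apply: lt_le_trans d1.
have -> : 4 / mu ^+ 2 * (d2 (j.+1%:Z, n) ^+ 2)^-1 =
    (mu * d2 (j.+1%:Z, n) * (mu / 4 * d2 (j.+1%:Z, n)))^-1.
  by field; rewrite !gt_eqF.
have p4 : 0 < mu / 4 * d2 (j.+1%:Z, n) by rewrite mulr_gt0 // divr_gt0.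
have L0 := lt_le_trans m0 ml; have H0 := lt_le_trans p4 h4.
rewrite lef_pV2 ?posrE; [|exact: mulr_gt0|exact: mulr_gt0].
by rewrite ler_pM // ltW.
Qed.


(** * From the polynomial part to the theta product *)

Let dl : R := pi * om1 / eta.

Let dl_gt0 : 0 < dl.
Proof. by rewrite divr_gt0 // mulr_gt0 // pi_gt0. Qed.

(** Multiplication by [a] takes the periods 2 [o1] and 2 [o3] to dl and i pi, so that each row
    becomes the zero set of [csinh2] shifted by a multiple of dl. *)
Let a : R[i] := (pi / (2 * eta))%:C.

Let a_neq0 : a != 0.
Proof.
by rewrite (_ : 0 = 0%:C) // (inj_eq (@complexI R)) gt_eqF // divr_gt0 ?pi_gt0 // mulr_gt0.
Qed.

Let sine_box M y : R[i] := \prod_(n <- int_box M) (y + 0 +i* (pi * n%:~R)).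

Let sine_part M y : R[i] := 2 * y * \prod_(k < M) (1 + y ^+ 2 / ((pi * k.+1%:R) ^+ 2)%:C).

Let pik_neq0 (k : nat) : ((pi * k.+1%:R) ^+ 2)%:C != 0 :> R[i].
Proof.
rewrite (_ : 0 = 0%:C) // (inj_eq (@complexI R)) expf_neq0 // mulf_neq0 ?pnatr_eq0 //.
by rewrite gt_eqF // pi_gt0.
Qed.

(** The two normalisations differ by a constant independent of [y], which cancels in the quotients
    of [poly_box_limit]. *)
Let sine_boxE M y :
  sine_box M y = sine_part M y * (2^-1 * \prod_(k < M) ((pi * k.+1%:R) ^+ 2)%:C).
Proof.
rewrite /sine_box /sine_part big_int_box /= mulr0 addr0.
rewrite (_ : forall p q : R[i], 2 * y * p * (2^-1 * q) = y * (p * q)); last first.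
  by move=> p q; field.
rewrite -big_split /=; congr (_ * _); apply: eq_bigr => k _.
rewrite [RHS]mulrDl mul1r divfK ?pik_neq0 //.
have -> : 0 +i* (pi * (- k.+1%:Z)%:~R) = - (0 +i* (pi * k.+1%:R)) :> R[i].
  by apply/eqP; rewrite eq_complex /= oppr0 rmorphN mulrN !eqxx.
rewrite -[in X in _ + X]/(pi * k.+1%:R).
have -> : ((pi * k.+1%:R) ^+ 2)%:C = - (0 +i* (pi * k.+1%:R)) ^+ 2 :> R[i].
  by apply/eqP; rewrite eq_complex /= !expr2 /=; apply/andP; split; apply/eqP; ring.
rewrite -pmulrn; ring.
Qed.

Let csinh2_real_neq0 (t : R) : 0 < t -> csinh2 t%:C != 0.
Proof.
move=> t0; rewrite /csinh2 -rmorphN !cexp_real -rmorphB (_ : 0 = 0%:C) // (inj_eq (@complexI R)).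
by rewrite subr_eq0 gt_eqF // ltr_expR; lra.
Qed.

Let a_l m n : a * l (m, n) = (dl * m%:~R)%:C + 0 +i* (pi * n%:~R).
Proof.
rewrite l_pair /a /dl; apply/eqP; rewrite eq_complex /=; apply/andP; split; apply/eqP.
  by field; rewrite gt_eqF.
by field; rewrite gt_eqF.
Qed.

(** In each full row, 1 - z^2/l^2 = (l - z)(l + z)/l^2 turns the product over n into a quotient of
    values of [sine_box], which become [csinh2] in the limit after normalisation. The half row m =
    0, together with the factor z, gives csinh2(a z) / (2a). *)
Let poly_box_limit z K :
  ctends (poly_box z K) ((2 * a)^-1 * theta_prod dl K (a * z)).
Proof.
have S y : ctends (sine_part^~ y) (csinh2 y) by apply: sine_product.
have h2 : (2 : R[i]) != 0 by rewrite pnatr_eq0.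
have c0 M : 2^-1 * \prod_(k < M) ((pi * k.+1%:R) ^+ 2)%:C != 0 :> R[i].
  by rewrite mulf_neq0 ?invr_neq0 //; apply/prodf_neq0 => k _; apply: pik_neq0.
pose row M (k : nat) := sine_part M ((dl * k.+1%:R)%:C - a * z) *
  sine_part M ((dl * k.+1%:R)%:C + a * z) / sine_part M (dl * k.+1%:R)%:C ^+ 2.
apply: (@eq_ctends _ (fun M => (2 * a)^-1 * (sine_part M (a * z) * \prod_(k < K) row M k))).
  move=> M; rewrite /poly_box big_half_box /= mulrA [in RHS]mulrA; congr (_ * _).
    rewrite /sine_part mulrA (_ : (2 * a)^-1 * (2 * (a * z)) = z); last first.
      by move: a a_neq0 => b b0; field.
    congr (_ * _); apply: eq_bigr => k _.
    have l0 : l (0, k.+1%:Z) != 0.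
      have [m0 ml] := @l_sqr_lb (0, k.+1%:Z) isT.
      by apply/eqP => e; move: m0 ml; rewrite e expr0n cabs0; lra.
    have -> : ((pi * k.+1%:R) ^+ 2)%:C = - (a * l (0, k.+1%:Z)) ^+ 2.
      rewrite a_l mulr0 add0r -pmulrn.
      by apply/eqP; rewrite eq_complex /= !expr2 /=; apply/andP; split; apply/eqP; ring.
    by move: (l _) a a_neq0 l0 => m b b0 m0; field; rewrite b0 m0.
  apply: eq_bigr => k _.
  have l0 n : l (k.+1%:Z, n) != 0.
    have [m0 ml] := @l_sqr_lb (k.+1%:Z, n) isT.
    by apply/eqP => e; move: m0 ml; rewrite e expr0n cabs0; lra.
  have E y : \prod_(n <- int_box M) (a * l (k.+1%:Z, n) + y) = sine_box M ((dl * k.+1%:R)%:C + y).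
    by apply: eq_bigr => n _; rewrite a_l addrAC -pmulrn.
  have -> : row M k = sine_box M ((dl * k.+1%:R)%:C - a * z) *
      sine_box M ((dl * k.+1%:R)%:C + a * z) / sine_box M (dl * k.+1%:R)%:C ^+ 2.
    rewrite !sine_boxE /row; move: (_ * \prod_(_ < M) _) (c0 M) => c c1.
    move: (sine_part M _) (sine_part M _) (sine_part M _) => A B D.
    by rewrite mulrACA -expr2 exprMn -[RHS]mulf_div divff ?mulr1 // expf_neq0.
  rewrite -[X in sine_box M X ^+ 2]addr0 -!E expr2 invfM mulrA -prodfV -!big_split /=.
  apply: eq_bigr => n _; rewrite addr0; move: (l _) a a_neq0 (l0 n) => m b b0 m0.
  by field; rewrite b0 m0.
rewrite /theta_prod; apply: ctendsZ; apply: ctendsM; first exact: S.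
apply: ctends_prod => k; apply: ctendsM; first by apply: ctendsM; apply: S.
apply: ctendsV; last by apply: ctendsX; apply: S.
by rewrite expf_neq0 // csinh2_real_neq0 // mulr_gt0 ?ltr0n.
Qed.

Lemma ctends_three_term (f : nat -> R[i] -> R[i]) (F : R[i] -> R[i]) x y z t :
  (forall u, ctends (f^~ u) (F u)) ->
  ctends (fun n => three_term (f n) x y z t) (three_term F x y z t).
Proof.
move=> h; rewrite /three_term.
by apply: ctendsD; [apply: ctendsD|];
   apply: ctendsM => //; apply: ctendsM => //; apply: ctendsM.
Qed.

Lemma three_term_scale (c k : R[i]) (f : R[i] -> R[i]) x y z t :
  three_term (fun u => c * f (k * u)) x y z t =
  c ^+ 4 * three_term f (k * x) (k * y) (k * z) (k * t).
Proof. by rewrite /three_term !mulrDr !mulrN; ring. Qed.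

(* The exponents of the three terms add up to the same quantity, by the parallelogram law. *)
Lemma three_term_gaussian (c : R[i]) (f : R[i] -> R[i]) x y z t :
  three_term (fun u => cexp (u ^+ 2 * c) * f u) x y z t =
  cexp (2 * (x ^+ 2 + y ^+ 2 + z ^+ 2 + t ^+ 2) * c) * three_term f x y z t.
Proof.
have par (p q r s : R[i]) : p ^+ 2 + q ^+ 2 + r ^+ 2 + s ^+ 2 = x ^+ 2 + y ^+ 2 + z ^+ 2 + t ^+ 2 ->
   cexp ((p + q) ^+ 2 * c) * f (p + q) * (cexp ((p - q) ^+ 2 * c) * f (p - q)) *
   (cexp ((r + s) ^+ 2 * c) * f (r + s)) * (cexp ((r - s) ^+ 2 * c) * f (r - s)) =
   cexp (2 * (x ^+ 2 + y ^+ 2 + z ^+ 2 + t ^+ 2) * c) *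
   (f (p + q) * f (p - q) * f (r + s) * f (r - s)).
  move=> <-; have -> : cexp (2 * (p ^+ 2 + q ^+ 2 + r ^+ 2 + s ^+ 2) * c) =
    cexp ((p + q) ^+ 2 * c) * cexp ((p - q) ^+ 2 * c) * cexp ((r + s) ^+ 2 * c) *
    cexp ((r - s) ^+ 2 * c) by rewrite -!cexpD; congr cexp; ring.
  ring.
rewrite /three_term !par ?mulrDr //; ring.
Qed.

Lemma sigma_three_term x y z t : three_term (sigma o1 o3) x y z t = 0.
Proof.
have [T T3 [c hT]] := theta_prod_limit dl_gt0.
have [B hB] := expo_bounded.
pose th K u := (2 * a)^-1 * theta_prod dl K (a * u).
have th0 : ctends (fun K => three_term (th K) x y z t) 0.
  have -> : 0 = three_term (fun u => (2 * a)^-1 * c * T (a * u)) x y z t.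
    by rewrite three_term_scale T3 mulr0.
  by apply: ctends_three_term => u; rewrite -mulrA; apply: ctendsZ; apply: hT.
(* M is taken at least K, so that [sigma_box_cvg] and [expo_bounded] apply, and so large that the
   three-term expression of the polynomial is close to its limit in M. A choice function then makes
   M depend on K. *)
have ex K : exists M, (K <= M)%N /\
    cabs (three_term (fun u => poly_box u K M) x y z t - three_term (th K) x y z t) < 1 / K.+1%:R.
  have h := @ctends_three_term (fun M u => poly_box u K M) (th K) x y z t (fun u => poly_box_limit u K).
  have [N hN] := h (1 / K.+1%:R) (divr_gt0 ltr01 (ltr0Sn _ _)).
  by exists (maxn K N); rewrite leq_maxl; split => //; apply: hN; apply: leq_maxr.
have [f hf] := choice ex.
have p0 : ctends (fun K => three_term (fun u => poly_box u K (f K)) x y z t) 0.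
  rewrite -[0]addr0; apply: (@eq_ctends _ (fun K => three_term (th K) x y z t +
    (three_term (fun u => poly_box u K (f K)) x y z t - three_term (th K) x y z t))).
    by move=> K; rewrite addrC subrK.
  apply: ctendsD => //; apply: (@ctends_le _ _ _ 1) => K; rewrite subr0.
  by apply: ltW; have [_] := hf K.
apply: (@ctends_uniq _ (fun K => three_term (fun u => sigma_box u K (f K)) x y z t)).
  apply: ctends_three_term => u; have [C hC] := sigma_box_cvg u.
  by apply: (@ctends_le _ _ _ C) => K; apply: hC; have [] := hf K.
apply: (@eq_ctends _ (fun K => cexp (2 * (x ^+ 2 + y ^+ 2 + z ^+ 2 + t ^+ 2) * expo K (f K)) *
    three_term (fun u => poly_box u K (f K)) x y z t)).
  move=> K; rewrite -three_term_gaussian.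
  by congr (three_term _ _ _ _ _); apply: funext => u; rewrite sigma_box_expo.
(* A bounded factor times a null sequence: the exponents [expo K (f K)] have a common bound. *)
apply: (@ctends0M _ _ _ (expR (cabs (2 * (x ^+ 2 + y ^+ 2 + z ^+ 2 + t ^+ 2)) * B))) => // K.
rewrite (le_trans (cabs_cexp_le _)) // ler_expR cabsM ler_wpM2l ?cabs_ge0 //.
by apply: hB; have [] := hf K.
Qed.

End SigmaProduct.

(** * The recurrence relation *)

(** The coefficients d_n and b_n have as many elliptic numbers above as below, so the normalisation
    by sigma(w) cancels. *)
Lemma homogeneous_ratio3 (F : fieldType) (s g a1 a2 a3 b1 b2 b3 : F) :
  s != 0 -> b1 != 0 -> b2 != 0 -> b3 != 0 ->
  g * (a1 / s * (a2 / s) * (a3 / s) / (b1 / s * (b2 / s) * (b3 / s))) =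
  g * (a1 * a2 * a3) / (b1 * b2 * b3).
Proof. by move=> s0 h1 h2 h3; field; rewrite s0 h1 h2 h3. Qed.

Lemma homogeneous_ratio4 (F : fieldType) (s g a1 a2 a3 b1 b2 b3 b4 : F) :
  s != 0 -> b1 != 0 -> b2 != 0 -> b3 != 0 -> b4 != 0 ->
  g * ((a1 / s) ^+ 2 * (a2 / s) * (a3 / s) / (b1 / s * (b2 / s) * (b3 / s) * (b4 / s))) =
  g * (a1 ^+ 2 * a2 * a3) / (b1 * b2 * b3 * b4).
Proof. by move=> s0 h1 h2 h3 h4; field; rewrite s0 h1 h2 h3 h4. Qed.

Theorem mainTheorem4 (R : realType) (omega1 : R) (omega3 : R[i]) (w : R)
    (alpha beta gamma : R[i])
    (omega1_gt0 : 0 < omega1)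
    (omega3_Re : complex.Re omega3 = 0)
    (omega3_Im : 0 < complex.Im omega3)
    (w_generic : forall N1 N2 : int, (N1, N2) <> (0, 0) ->
       w * N1%:~R <> omega1 * N2%:~R)
    (alpha_generic : forall k : int,
       ~ lattice omega1%:C omega3 (alpha - w%:C * k%:~R))
    (beta_generic : forall n : nat,
       ~ lattice omega1%:C omega3 (beta + n%:R * alpha))
    (beta_generic' : forall n : nat,
       ~ lattice omega1%:C omega3 (beta + n%:R * (alpha + w%:C))) :
  let c := moment omega1%:C omega3 w alpha beta gamma in
  let P := lbp c in
  let d := coef_d omega1%:C omega3 w alpha beta gamma in
  let b := coef_b omega1%:C omega3 w alpha beta gamma in
  [/\ forall n : nat, Delta c n != 0 /\ P n \is monic,
      P 0%N = 1,
      P 1%N = 'X - (d 0%N)%:P &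
      forall n : nat, (1 <= n)%N ->
        P n.+1 + ((d n)%:P - 'X) * P n = 'X * (b n)%:P * P n.-1].
Proof.
case: omega3 omega3_Re omega3_Im alpha_generic beta_generic beta_generic' => re eta re0 eta0.
move: re0 eta0; rewrite [X in X = 0]/= [X in 0 < X]/= => {re}-> eta0.
move=> alpha_generic beta_generic beta_generic'.
set S := sigma omega1%:C (0 +i* eta).
have SN x : S (- x) = - S x := sigmaN omega1_gt0 eta0 x.
have S3 x y z t : three_term S x y z t = 0 := sigma_three_term omega1_gt0 eta0 x y z t.
have S0 x : ~ lattice omega1%:C (0 +i* eta) x -> S x != 0 := @sigma_neq0 R _ _ omega1_gt0 eta0 x.
have w0 : w%:C != 0.
  rewrite (_ : 0 = 0%:C) // (inj_eq (@complexI R)); apply/eqP => w0.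
  by apply: (w_generic 1 0) => //; rewrite w0 mul0r mulr0.
(* If the real number w (n+1) were a lattice point, its coefficient on 2 omega3 would be 0, hence w
   (n+1) = omega1 (2m), against [w_generic]. *)
have Sw n : S (w%:C * n.+1%:R) != 0.
  apply: S0 => -[m [k]]; rewrite /lattice_pt => /eqP.
  rewrite -(rmorph_nat (real_complex R)) -rmorphM -!(rmorph_int (real_complex R)).
  rewrite eq_complex /= => /andP[/eqP hre /eqP him].
  have k0 : k%:~R = 0 :> R.
    have e : eta * k%:~R = 0 by lra.
    by move/eqP: e; rewrite mulf_eq0 gt_eqF //= => /eqP.
  apply: (w_generic n.+1%:Z (2 * m)) => //.
  by rewrite -pmulrn rmorphM /= hre k0; ring.
have Sa k : S (alpha + w%:C * k%:~R) != 0.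
  by apply: S0; have := alpha_generic (- k); rewrite rmorphN mulrN opprK.
have Sb n : S (beta + n%:R * alpha) != 0 by apply: S0.
have Sb' n : S (beta + n%:R * (alpha + w%:C)) != 0 by apply: S0.
pose g : R[i] := cexp (gamma * w%:C).
pose C0 : R[i] := cexp (gamma * alpha) / S beta.
have g0 : g != 0 by apply: cexp_neq0.
have Sbeta : S beta != 0 by have := Sb 0%N; rewrite mul0r addr0.
have C00 : C0 != 0 by rewrite mulf_neq0 ?invr_neq0 // cexp_neq0.
move=> c P d b.
(* The exponential splits into g^k and a constant, which joins 1/sigma(beta) in [C0]. *)
have cE : c = fun k : int =>
    C0 * g ^ k * (S (w%:C * k%:~R + beta + alpha) / S (w%:C * k%:~R + alpha)).
  apply: funext => k; rewrite /c /moment /C0 /g cexpD cexp_int -/S invfM; ring.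
have Sww : S w%:C != 0 by have := Sw 0%N; rewrite mulr1.
have brE x y : w%:C * x = y -> elliptic_number omega1%:C (0 +i* eta) w x = S y / S w%:C.
  by rewrite /elliptic_number => ->.
have wa : w%:C * (alpha / w%:C) = alpha by rewrite mulrC divfK.
have wb : w%:C * (beta / w%:C) = beta by rewrite mulrC divfK.
have e1 n : w%:C * (alpha / w%:C - n%:R) = alpha - w%:C * n%:R by rewrite mulrBr wa.
have e2 n : w%:C * (alpha / w%:C + n%:R + 1) = alpha + w%:C * n.+1%:R.
  by rewrite -addrA natr1 mulrDr wa.
have e3 n : w%:C * (beta / w%:C + (alpha / w%:C + 1) * n%:R) = beta + n%:R * (alpha + w%:C).
  by rewrite mulrDr wb mulrA mulrDr wa mulr1 mulrC.
have e4 n : w%:C * (beta / w%:C + alpha / w%:C * n%:R) = beta + n%:R * alpha.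
  by rewrite mulrDr wb mulrA wa mulrC.
have e5 n : w%:C * (alpha / w%:C + n%:R) = alpha + w%:C * n%:R by rewrite mulrDr wa.
have Sa' n : S (alpha + w%:C * n%:R) != 0 by apply: (Sa n%:Z).
have dE n : d n = ell_d S w%:C alpha beta g n.
  rewrite /d /coef_d /ell_d !natr1 (brE _ _ (e1 _)) (brE _ _ (e3 _)) (brE _ _ (e4 _)).
  rewrite (brE _ _ (e2 _)) (brE _ _ (e3 _)) (brE _ _ (e4 _)) -/g.
  by rewrite homogeneous_ratio3.
have bE n : b n.+1 = ell_b S w%:C alpha beta g n.
  rewrite /b /coef_b /ell_b !natr1 (_ : n.+1%:R - 1 = n%:R); last by rewrite -natr1 addrK.
  rewrite (brE _ _ erefl) (brE _ _ (e3 _)) (brE _ _ (e4 _)) (brE _ _ (e3 _)) (brE _ _ (e4 _)).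
  rewrite (brE _ _ (e5 _)) (brE _ _ (e2 _)) -/g.
  by rewrite homogeneous_ratio4.
have PE n : P n = ell_poly S w%:C alpha beta g n.
  by rewrite /P cE; apply: lbp_ell_poly.
split.
- move=> n; split; last by rewrite PE; have [] := ell_poly_monic S w%:C alpha beta g n.
  by rewrite cE; apply: ell_Delta_neq0.
- by rewrite PE.
- by rewrite PE dE.
- case=> // n _; rewrite !PE dE bE ell_polySS /=; ring.
Qed.
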